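(* Let $K$ be an imaginary quadratic field with ring of integers $\mathcal{O}_K$. Then $\mathcal{O}_K$ has a Euclidean ideal if and only if $K=\mathbb{Q}(\sqrt{-D})$ with $D\in\{1,2,3,5,7,11,15\}$. Among these, $K$ has class number $1$ for $D\in\{1,2,3,7,11\}$ and class number $2$ for $D\in\{5,15\}$. Moreover, in each of these seven cases the unique ideal class that generates the class group of $\mathcal{O}_K$ is norm-Euclidean.
   Context: Let $R$ be a Dedekind domain with fraction field $K$, and let $E$ denote the set of fractional ideals of $R$ in $K$ that contain $R$. A nonzero ideal $C\subseteq R$ is called Euclidean if there exists a function $\psi:E\to\mathbb{N}$ (with $0\in\mathbb{N}$) such that for all $I\in E$ and all $x\in IC\setminus C$ there exists $y\in C$ with $\psi((x+y)^{-1}IC)<\psi(I)$; such $\psi$ is a Euclidean algorithm for $C$. A function $\psi$ is a Euclidean algorithm for $C$ if and only if it is one for every ideal in the ideal class of $C$, so one speaks of a Euclidean ideal class. An ideal (class) $C$ is norm-Euclidean if the function $I\mapsto \mathrm{Nm}(I^{-1})=|R/I^{-1}|$ on $E$ is a Euclidean algorithm for $C$; for $R=\mathcal{O}_K$ with $K$ imaginary quadratic this is equivalent to: for every $I\in E$ and $x\in IC\setminus C$ there is $y\in C$ with $\mathrm{Nm}(x+y)<\mathrm{Nm}(C)$, where $\mathrm{Nm}$ is the absolute norm. Here $D$ denotes a squarefree positive integer. *)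

(* Defs.v *)
(* the imaginary quadratic field Q(sqrt(-D)) is realised
   inside the algebraic complex numbers algC; its ring of integers is
   K ∩ Aint (algebraic integers, algnum.v).  Subsets of K are predicates
   algC -> Prop. *)
From mathcomp Require Import all_boot all_order all_algebra all_field.
Set Implicit Arguments. Unset Strict Implicit. Unset Printing Implicit Defensive.
Import Order.TTheory GRing.Theory Num.Theory.
Local Open Scope ring_scope.

Definition squarefree (D : nat) : Prop :=
  forall p : nat, prime p -> ~~ (p * p %| D)%N.

Definition sqrtmD (D : nat) : algC := sqrtC (- (D%:R)).

Definition QF (D : nat) (x : algC) : Prop :=
  exists a b : rat, x = ratr a + ratr b * sqrtmD D.

Definition OK (D : nat) (x : algC) : Prop := QF D x /\ x \in Aint.

Definition int_ideal (D : nat) (C : algC -> Prop) : Prop :=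
  [/\ forall x, C x -> OK D x,
      C 0,
      exists x, C x /\ x != 0,
      forall x y, C x -> C y -> C (x + y)
    & forall r x, OK D r -> C x -> C (r * x)].

Definition frac_ideal (D : nat) (I : algC -> Prop) : Prop :=
  [/\ forall x, I x -> QF D x,
      I 0,
      exists x, I x /\ x != 0,
      forall x y, I x -> I y -> I (x + y)
    & forall r x, OK D r -> I x -> I (r * x)] /\
  exists d, [/\ OK D d, d != 0 & forall x, I x -> OK D (d * x)].

Definition Eset (D : nat) (I : algC -> Prop) : Prop :=
  frac_ideal D I /\ forall x, OK D x -> I x.

Definition prodset (I J : algC -> Prop) (z : algC) : Prop :=
  exists (n : nat) (a b : 'I_n -> algC),
    [/\ forall i, I (a i), forall i, J (b i) & z = \sum_(i < n) a i * b i].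

Definition scaleset (a : algC) (I : algC -> Prop) (z : algC) : Prop :=
  exists w, I w /\ z = a * w.

Definition euclid_alg (D : nat) (C : algC -> Prop)
    (psi : (algC -> Prop) -> nat) : Prop :=
  forall I, Eset D I ->
  forall x, prodset I C x -> ~ C x ->
  exists y, C y /\ (psi (scaleset (x + y)^-1 (prodset I C)) < psi I)%N.

Definition euclidean_ideal (D : nat) (C : algC -> Prop) : Prop :=
  int_ideal D C /\ exists psi, euclid_alg D C psi.

Definition has_euclidean_ideal (D : nat) : Prop :=
  exists C, euclidean_ideal D C.

Definition finv (D : nat) (I : algC -> Prop) (z : algC) : Prop :=
  QF D z /\ forall w, I w -> OK D (z * w).

Definition ideal_index (D : nat) (J : algC -> Prop) (n : nat) : Prop :=
  exists r : 'I_n -> algC,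
    [/\ forall i, OK D (r i),
        forall i j, J (r i - r j) -> i = j
      & forall z, OK D z -> exists i, J (z - r i)].

(* C is norm-Euclidean: psi(I) = Nm(I^-1) = |O_K / I^-1| is a Euclidean
   algorithm for C (psi given relationally since the index is unique) *)
Definition norm_euclidean (D : nat) (C : algC -> Prop) : Prop :=
  int_ideal D C /\
  forall I, Eset D I ->
  forall x, prodset I C x -> ~ C x ->
  exists y, C y /\
    exists m n : nat,
      [/\ ideal_index D (finv D (scaleset (x + y)^-1 (prodset I C))) m,
          ideal_index D (finv D I) n & (m < n)%N].

Definition ideal_equiv (D : nat) (I J : algC -> Prop) : Prop :=
  exists a, [/\ QF D a, a != 0 & forall z, J z <-> scaleset a I z].

Fixpoint ideal_pow (D : nat) (C : algC -> Prop) (k : nat) : algC -> Prop :=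
  match k with
  | 0 => OK D
  | k'.+1 => prodset (ideal_pow D C k') C
  end.

Definition generates_class_group (D : nat) (C : algC -> Prop) : Prop :=
  forall I, frac_ideal D I -> exists k, ideal_equiv D I (ideal_pow D C k).

Definition has_class_number (D : nat) (n : nat) : Prop :=
  exists r : 'I_n -> (algC -> Prop),
    [/\ forall i, frac_ideal D (r i),
        forall i j, ideal_equiv D (r i) (r j) -> i = j
      & forall I, frac_ideal D I -> exists i, ideal_equiv D I (r i)].

(* Main.v *)
(** Write N(I) for the positive rational r with I * conj(I) = r O, and choose a
    reduced basis of an ideal C, in which the norm is N(C) Q for an integral form
    Q = (a, b, c) with 0 <= b <= a <= c and discriminant equal to that of the field.
    The squared covering radius of C is N(C) rho with
    rho = a c (a + c - b) / (4 a c - b^2).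

    If rho < 1, every point of K lies at norm less than N(C) from C; by
    multiplicativity of N, the passage from I to (x + y)^-1 I C then decreases
    N(I^-1), so C is norm-Euclidean.  If rho > 1, the circumcentre h of a
    fundamental triangle is a hole: points close to h have norm distance at least
    N(C) from C.  As soon as N(I) is small, I C has a point x close to h, and
    every ideal (x + y)^-1 I C again has norm at most N(I); hence any Euclidean
    algorithm would have an infinite descent on {I : N(I) small}.

    Enumerating reduced forms, rho > 1 for every ideal when D is not in the list;
    for D in the list rho < 1, except for principal ideals when D = 5 or 15, and
    those do not generate the class group. *)

Require Import Defs.
From Stdlib Require Import ClassicalEpsilon.
From mathcomp Require Import all_boot all_order all_algebra all_field.
From mathcomp Require Import zify ring lra.
Import Order.TTheory GRing.Theory Num.Theory.
Local Open Scope ring_scope.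

Local Notation CQ := (@ratr algC).

Lemma CQ_inj : injective CQ.
Proof. exact: fmorph_inj. Qed.

(** * The imaginary quadratic field: conjugation, norm and trace *)

Section QuadraticField.
Variables (D : nat) (D_gt0 : (0 < D)%N).
Local Notation s := (sqrtmD D).

Lemma sqrtmD_sqr : s ^+ 2 = - D%:R.
Proof. exact: sqrtCK. Qed.

(** Both sides have the same square, so the conjugate is [s] or [- s]; the first would make [s] real
    with the negative square [- D%:R]. *)
Lemma conj_sqrtmD : s^* = - s.
Proof.
have sq0 : s^* ^+ 2 = s ^+ 2 by rewrite -rmorphXn /= sqrtmD_sqr rmorphN /= conjC_nat.
have : (s^* - s) * (s^* + s) = 0 by rewrite -subr_sqr sq0 subrr.
move/eqP; rewrite mulf_eq0 subr_eq0 addr_eq0 => /orP[/eqP/CrealP sR|/eqP//].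
have := real_exprn_even_ge0 (n := 2) sR isT.
by rewrite sqrtmD_sqr oppr_ge0 lern0 -leqn0 leqNgt D_gt0.
Qed.

Lemma conj_ratr (a : rat) : (CQ a)^* = CQ a.
Proof. by rewrite conj_Crat ?Crat_rat. Qed.

Lemma conj_QF (a b : rat) : (CQ a + CQ b * s)^* = CQ a - CQ b * s.
Proof.
by rewrite rmorphD /= conj_ratr (rmorphM Num.conj) /= conj_ratr conj_sqrtmD mulrN.
Qed.

(** Adding the conjugate relation isolates [2 a = 0]; then [b = 0] because [s] has nonzero
    square. *)
Lemma sqrtmD_inj (a b : rat) : CQ a + CQ b * s = 0 -> a = 0 /\ b = 0.
Proof.
move=> e; have e' : CQ a - CQ b * s = 0.
  have := congr1 (fun z : algC => z^*) e.
  by rewrite /= conj_QF rmorph0.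
have a0 : CQ (a * 2) = CQ 0.
  rewrite rmorph0 -[RHS](addr0 0) -{1}e -e'.
  by ring.
have {}a0 : a = 0 by move/fmorph_inj: a0; lra.
split=> //; move: e; rewrite a0 rmorph0 add0r => /eqP.
rewrite mulf_eq0 fmorph_eq0 => /orP[/eqP//|/eqP s0].
have /eqP := sqrtmD_sqr; rewrite s0 expr0n /= eq_sym oppr_eq0 pnatr_eq0.
by move: D_gt0; case: D.
Qed.

Lemma QF_rat (a : rat) : QF D (CQ a).
Proof. by exists a, 0; rewrite rmorph0 mul0r addr0. Qed.

Lemma QF_add x y : QF D x -> QF D y -> QF D (x + y).
Proof. by move=> [a [b ->]] [c [d ->]]; exists (a + c), (b + d); ring. Qed.

Lemma QF_opp x : QF D x -> QF D (- x).
Proof. by move=> [a [b ->]]; exists (- a), (- b); ring. Qed.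

Lemma QF_sub x y : QF D x -> QF D y -> QF D (x - y).
Proof. by move=> Kx Ky; apply/QF_add/QF_opp. Qed.

Lemma QF_mul x y : QF D x -> QF D y -> QF D (x * y).
Proof.
move=> [a [b ->]] [c [d ->]]; exists (a * c - b * d * D%:R), (a * d + b * c).
have := sqrtmD_sqr; set t := s => e.
have -> : (ratr a + ratr b * t) * (ratr c + ratr d * t)
  = ratr a * ratr c + ratr b * ratr d * t ^+ 2
    + (ratr a * ratr d + ratr b * ratr c) * t by ring.
by rewrite e; ring.
Qed.

Lemma QF_conj x : QF D x -> QF D x^*.
Proof.
move=> [a [b ->]]; exists a, (- b).
by rewrite conj_QF; ring.
Qed.

Lemma normQF (a b : rat) :
  (CQ a + CQ b * s) * (CQ a + CQ b * s)^* = CQ (a ^+ 2 + D%:R * b ^+ 2).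
Proof.
rewrite conj_QF.
have := sqrtmD_sqr; set t := s => e.
have -> : (ratr a + ratr b * t) * (ratr a - ratr b * t)
  = ratr a ^+ 2 - ratr b ^+ 2 * t ^+ 2 by ring.
by rewrite e; ring.
Qed.

(* [getCrat] is a junk value outside of [Crat]; for [x] in [QF D] the
   product [x * x^*] is rational. *)
Definition nrm (x : algC) : rat := getCrat (x * x^*).
Definition trc (x y : algC) : rat := getCrat (x * y^* + x^* * y).

Lemma nrmE x : QF D x -> CQ (nrm x) = x * x^*.
Proof.
move=> [a [b ->]]; rewrite /nrm getCratK //.
by rewrite normQF Crat_rat.
Qed.

Lemma trcE x y : QF D x -> QF D y -> CQ (trc x y) = x * y^* + x^* * y.
Proof.
move=> [a [b ->]] [c [d ->]]; rewrite /trc getCratK //.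
rewrite !conj_QF.
have := sqrtmD_sqr; set t := s => e.
suff -> : (ratr a + ratr b * t) * (ratr c - ratr d * t) +
    (ratr a - ratr b * t) * (ratr c + ratr d * t)
    = CQ (2 * (a * c + D%:R * (b * d))) by rewrite Crat_rat.
transitivity (2 * (ratr a * ratr c - ratr b * ratr d * t ^+ 2)); first by ring.
by rewrite e; ring.
Qed.

Lemma nrm_ge0 x : QF D x -> 0 <= nrm x.
Proof.
by move=> Kx; rewrite -(ler0q algC) nrmE // mul_conjC_ge0.
Qed.

Lemma nrm_eq0 x : QF D x -> (nrm x == 0) = (x == 0).
Proof.
by move=> Kx; rewrite -(fmorph_eq0 CQ) /= nrmE // mul_conjC_eq0.
Qed.

Lemma nrm_gt0 x : QF D x -> (0 < nrm x) = (x != 0).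
Proof. by move=> Kx; rewrite lt0r nrm_ge0 // andbT nrm_eq0. Qed.

Lemma nrmM x y : QF D x -> QF D y -> nrm (x * y) = nrm x * nrm y.
Proof.
move=> Kx Ky; apply: CQ_inj.
rewrite (rmorphM CQ) /= !nrmE //; last exact: QF_mul.
by rewrite (rmorphM Num.conj) /= mulrACA.
Qed.

Lemma nrm_rat (a : rat) : nrm (CQ a) = a ^+ 2.
Proof.
apply: CQ_inj; rewrite nrmE; last exact: QF_rat.
by rewrite conj_ratr -(rmorphM CQ).
Qed.

Lemma nrm_comb (x y : rat) a b : QF D a -> QF D b ->
  nrm (CQ x * a + CQ y * b) = x ^+ 2 * nrm a + x * y * trc a b + y ^+ 2 * nrm b.
Proof.
move=> Ka Kb; apply: CQ_inj; rewrite nrmE; last first.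
  by apply: QF_add; apply: QF_mul => //; apply: QF_rat.
rewrite (rmorphD Num.conj) /= (rmorphM Num.conj) /= conj_ratr.
rewrite (rmorphM Num.conj) /= conj_ratr.
transitivity (CQ x ^+ 2 * (a * a^*) + CQ x * CQ y * (a * b^* + a^* * b)
  + CQ y ^+ 2 * (b * b^*)); first by ring.
rewrite -(nrmE _ Ka) -(nrmE _ Kb) -(trcE _ _ Ka Kb).
by ring.
Qed.

Lemma QF_inv x : QF D x -> QF D x^-1.
Proof.
move=> Kx; have [->|x0] := eqVneq x 0; first by rewrite invr0 -(rmorph0 CQ); apply: QF_rat.
have -> : x^-1 = CQ (nrm x)^-1 * x^*.
  rewrite (fmorphV CQ) /= nrmE // invfM -mulrA mulVf ?mulr1 //.
  by rewrite conjC_eq0.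
by apply: QF_mul; [apply: QF_rat | apply: QF_conj].
Qed.

Lemma nrmV x : QF D x -> nrm x^-1 = (nrm x)^-1.
Proof.
move=> Kx; apply: CQ_inj.
rewrite (fmorphV CQ) /= !nrmE //; last exact: QF_inv.
by rewrite (fmorphV Num.conj) /= invfM.
Qed.

End QuadraticField.

(** * The ring of integers and its basis 1, [omega] *)

Lemma int_parity (m : int) : exists i j : int, (j = 0 \/ j = 1) /\ m = 2 * i + j.
Proof. by exists (m %/ 2)%Z, (m %% 2)%Z; lia. Qed.

(** If a prime [p] divided the denominator of [q], then [p ^ 2] would divide [D] times the squared
    numerator; it is coprime to the numerator, so it would divide [D]. *)
Lemma squarefree_rat_int (D : nat) (q : rat) :
  squarefree D -> D%:R * q ^+ 2 \is a Num.int -> q \is a Num.int.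
Proof.
move=> sqD /intrP [k Dq].
have eZ : D%:Z * numq q ^+ 2 = k * denq q ^+ 2.
  apply: (intr_inj (R := rat)).
  have d0 : (denq q)%:~R != 0 :> rat by rewrite intr_eq0 denq_neq0.
  rewrite !(rmorphM, rmorphXn) /= -Dq numqE; ring.
have eN : (D * `|numq q| ^ 2 = `|k| * `|denq q| ^ 2)%N.
  by move/(congr1 absz): eZ; rewrite abszM abszX [in RHS]abszM abszX.
have d1 : `|denq q|%N = 1%N.
  apply/eqP; rewrite eqn_leq absz_gt0 denq_neq0 andbT leqNgt.
  apply/negP => d_gt1; have /negP := sqD _ (pdiv_prime d_gt1); apply.
  set p := pdiv _; have pd : (p %| `|denq q|)%N by apply: pdiv_dvd.
  have cop : coprime (p * p) (`|numq q| ^ 2).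
    rewrite mulnn coprimeXl // coprimeXr //.
    by apply: coprime_dvdl pd _; rewrite coprime_sym; apply: coprime_num_den.
  rewrite -(Gauss_dvdl _ cop) eN dvdn_mull // -mulnn dvdn_mul //.
have -> : q = (numq q)%:~R.
  by rewrite numqE -[denq q]gez0_abs ?d1 ?mulr1.
exact: intr_int.
Qed.

Section Integers.
Variables (D : nat) (D_gt0 : (0 < D)%N) (sqD : squarefree D).
Local Notation s := (sqrtmD D).

(** The usual generator of the ring of integers over the rational integers; [omega_tr] and
    [omega_nrm] are its trace and norm, the division by 4 being exact in the case where it
    occurs. *)
Definition omega : algC := if (D %% 4 == 3)%N then (1 + s) / 2 else s.
Definition omega_tr : int := (D %% 4 == 3)%N.
Definition omega_nrm : int := if (D %% 4 == 3)%N then (D.+1 %/ 4)%N else D.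
(** Absolute value of the field discriminant. *)
Definition absdisc : int := if (D %% 4 == 3)%N then D else (4 * D)%N.

Lemma absdiscE : absdisc = 4 * omega_nrm - omega_tr ^+ 2.
Proof. by rewrite /absdisc /omega_nrm /omega_tr; case: eqP => ?; lia. Qed.

Lemma absdisc_gt0 : 0 < absdisc.
Proof. by rewrite /absdisc; case: eqP => ?; lia. Qed.

Lemma omega_QF : QF D omega.
Proof.
rewrite /omega; case: ifP => _; [exists (1 / 2), (1 / 2) | exists 0, 1].
  by rewrite (fmorph_div CQ) /= !(rmorph1 CQ) (rmorph_nat CQ 2); field.
by rewrite (rmorph0 CQ) (rmorph1 CQ) add0r mul1r.
Qed.

Lemma omega_conj : omega^* = omega_tr%:~R - omega.
Proof.
rewrite /omega /omega_tr; case: ifP => _ /=.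
  rewrite (rmorphM Num.conj) (rmorphD Num.conj) (fmorphV Num.conj) /=.
  by rewrite conjC_nat conjC1 conj_sqrtmD //; field.
by rewrite conj_sqrtmD // sub0r.
Qed.

Lemma omega_sqr : omega ^+ 2 = omega_tr%:~R * omega - omega_nrm%:~R.
Proof.
have s2 := sqrtmD_sqr D.
rewrite /omega /omega_tr /omega_nrm; case: eqP => e /=; last first.
  by rewrite s2 mul0r sub0r.
have -> : ((1 + s) / 2) ^+ 2 = (1 + 2 * s + s ^+ 2) / 4 by field.
have De : D = (4 * (D.+1 %/ 4) - 1)%N by lia.
have -> : s ^+ 2 = 1 - 4 * (D.+1 %/ 4)%:R.
  rewrite s2 {1}De natrB; last by lia.
  by rewrite natrM; ring.
by rewrite -pmulrn; field.
Qed.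

Lemma omega_mul_conj : omega * omega^* = omega_nrm%:~R.
Proof. by rewrite omega_conj mulrBr -expr2 omega_sqr; ring. Qed.

Lemma ratr_omega_inj (a b : rat) : CQ a + CQ b * omega = 0 -> a = 0 /\ b = 0.
Proof.
rewrite /omega; case: ifP => _ e; last exact: (sqrtmD_inj D D_gt0).
have h2 : CQ 2 = 2 by exact: (rmorph_nat CQ 2).
have [] := sqrtmD_inj D D_gt0 (a + b / 2) (b / 2).
  by rewrite -e (rmorphD CQ) /= (fmorph_div CQ) /= h2; field.
by move=> h1 h2'; split; lra.
Qed.

Lemma int_omega_inj (a b : int) : a%:~R + b%:~R * omega = 0 -> a = 0 /\ b = 0.
Proof.
rewrite -!(ratr_int algC) => /ratr_omega_inj [/eqP + /eqP].
by rewrite !intr_eq0 => /eqP-> /eqP->.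
Qed.

Lemma QF_omega x : QF D x -> exists a b : rat, x = CQ a + CQ b * omega.
Proof.
move=> [a [b ->]]; rewrite /omega; case: ifP => _; last by exists a, b.
exists (a - b), (2 * b).
by rewrite (rmorphB CQ) (rmorphM CQ) (rmorph_nat CQ 2) /=; field.
Qed.

(** [omega] is a root of the monic polynomial [X^2 - omega_tr X + omega_nrm]. *)
Lemma Aint_omega : omega \in Aint.
Proof.
pose q : {poly algC} := omega_nrm%:~R%:P - omega_tr%:~R *: 'X.
have sz : (size q < size ('X^2 : {poly algC}))%N.
  rewrite size_polyXn (leq_ltn_trans (size_polyD _ _)) // gtn_max size_polyN.
  rewrite (leq_ltn_trans (size_polyC_leq1 _)) //=.
  by rewrite (leq_ltn_trans (size_scale_leq _ _)) ?size_polyX.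
apply: (@root_monic_Aint ('X^2 + q)).
- rewrite /root /q !(hornerD, hornerN, hornerXn, hornerC, hornerZ, hornerX) omega_sqr; apply/eqP; ring.
- by rewrite monicE lead_coefDl // lead_coefXn.
- apply/polyOverP => i; rewrite /q coefD coefXn coefB coefC coefZ coefX.
  by rewrite rpredD ?rpredB ?rpredM //; do ?[case: eqP => _ /=]; rewrite ?intr_int // ?rpred0 ?rpred1.
Qed.

(** For [x = a + b s] integral, the trace [m = 2 a] and the norm [n] are integers. Then
    [D (2 b)^2 = 4 n - m^2] is an integer, so [l = 2 b] is one because [D] is squarefree. Finally
    [m^2 + D l^2 = 4 n] read modulo 4 makes [m] and [l] of equal parity if [D] is 3 modulo 4, and
    both even otherwise. *)
Lemma OK_omega x :
  OK D x <-> exists a b : int, x = a%:~R + b%:~R * omega.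
Proof.
split=> [[[a [b ->]] xA]|[a [b ->]]]; last first.
  split.
    apply: QF_add; last apply: QF_mul => //; rewrite -?(ratr_int algC);
      by [apply: QF_rat | apply: omega_QF].
  by rewrite rpredD ?rpredM ?Aint_omega ?Aint_int.
have xA' : CQ a - CQ b * s \in Aint by rewrite -(conj_QF D D_gt0) Aint_aut.
have rat_int (q : rat) : CQ q \in Aint -> exists m : int, q = m%:~R.
  move=> qA; have /intrP [m e] := Cint_rat_Aint (Crat_rat q) qA.
  by exists m; apply: CQ_inj; rewrite e ratr_int.
have [m mE] : exists m : int, a * 2 = m%:~R.
  apply: rat_int; have -> : CQ (a * 2) = (CQ a + CQ b * s) + (CQ a - CQ b * s).
    by ring.
  exact: rpredD.
have [n nE] : exists n : int, a ^+ 2 + D%:R * b ^+ 2 = n%:~R.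
  by apply: rat_int; rewrite -normQF // conj_QF // rpredM.
have /(squarefree_rat_int _ _ sqD) /intrP [l lE] : D%:R * (b * 2) ^+ 2 \is a Num.int.
  have -> : D%:R * (b * 2) ^+ 2 = (4 * n - m ^+ 2)%:~R.
    by rewrite rmorphB rmorphM rmorphXn /= -mE -nE; ring.
  exact: intr_int.
have eZ : m ^+ 2 + D%:Z * l ^+ 2 = 4 * n.
  apply: (intr_inj (R := rat)).
  transitivity (m%:~R ^+ 2 + D%:R * l%:~R ^+ 2 : rat); first by ring.
  rewrite -mE -lE; transitivity (4 * n%:~R : rat); last by ring.
  by rewrite -nE; ring.
have aE : CQ a = m%:~R / 2.
  by rewrite -(ratr_int algC) -mE (rmorphM CQ) (rmorph_nat CQ 2) mulfK // pnatr_eq0.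
have bE : CQ b = l%:~R / 2.
  by rewrite -(ratr_int algC) -lE (rmorphM CQ) (rmorph_nat CQ 2) mulfK // pnatr_eq0.
have D4 : (D %% 4 != 0)%N.
  by have := sqD 2 isT; apply: contraNN => /eqP d0; lia.
have [m' [i [iE mi]]] := int_parity m; have [l' [j [jE lj]]] := int_parity l.
rewrite aE bE /omega; case: eqP => D3.
  have ij : i = j.
    have De : D%:Z = 4 * (D %/ 4)%N%:Z + 3 by lia.
    move: eZ; rewrite De mi lj; set e := Posz (_ %/ _).
    by case: iE => ->; case: jE => -> // h; exfalso; lia.
  exists (m' - l'), l; rewrite lj mi ij.
  by field.
have [i0 j0] : i = 0 /\ j = 0.
  have [c [c12 De]] : exists c : int, (c = 1 \/ c = 2) /\ D%:Z = 4 * (D %/ 4)%N%:Z + c.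
    by exists (D %% 4)%N; lia.
  move: eZ; rewrite De mi lj; set e := Posz (_ %/ _).
  by case: iE => ->; case: jE => -> //; case: c12 => -> h; exfalso; lia.
exists m', l'; rewrite mi lj i0 j0.
by field.
Qed.

End Integers.

(** * Fractional ideals: products, norms and inverses *)

Lemma prodset0 (I J : algC -> Prop) : prodset I J 0.
Proof.
exists 0, (fun=> 0), (fun=> 0); split; rewrite ?big_ord0 //; by case.
Qed.

Lemma prodset_mul (I J : algC -> Prop) x y : I x -> J y -> prodset I J (x * y).
Proof.
by move=> Ix Jy; exists 1, (fun=> x), (fun=> y); split; rewrite ?big_ord1.
Qed.

Lemma prodset_add (I J : algC -> Prop) z w :
  prodset I J z -> prodset I J w -> prodset I J (z + w).
Proof.
move=> [n [a [b [Ia Jb ->]]]] [m [c [d [Ic Jd ->]]]].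
exists (n + m)%N, (fun k => match split k with inl i => a i | inr i => c i end).
exists (fun k => match split k with inl i => b i | inr i => d i end).
split; try by move=> k; case: split.
rewrite big_split_ord /=; congr (_ + _); apply: eq_bigr => i _.
  by rewrite (unsplitK (inl i)).
by rewrite (unsplitK (inr i)).
Qed.

(** Replaces computations with finite sums: properties of product ideals are checked on generators
    only. *)
Lemma prodset_ind (I J P : algC -> Prop) :
  P 0 -> (forall z w, P z -> P w -> P (z + w)) ->
  (forall x y, I x -> J y -> P (x * y)) -> forall z, prodset I J z -> P z.
Proof.
move=> P0 PD PM z [n [a [b [Ia Jb ->]]]].
by apply: big_ind => // i _; apply: PM.
Qed.

Section Ideals.
Variables (D : nat) (D_gt0 : (0 < D)%N) (sqD : squarefree D).

Lemma OK_int (m : int) : OK D m%:~R.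
Proof. by split; [rewrite -ratr_int; apply: QF_rat | apply: Aint_int]. Qed.

Lemma OK_add x y : OK D x -> OK D y -> OK D (x + y).
Proof. by move=> [Kx Ax] [Ky Ay]; split; [apply: QF_add | apply: rpredD]. Qed.

Lemma OK_opp x : OK D x -> OK D (- x).
Proof. by move=> [Kx Ax]; split; [apply: QF_opp | rewrite rpredN]. Qed.

Lemma OK_mul x y : OK D x -> OK D y -> OK D (x * y).
Proof. by move=> [Kx Ax] [Ky Ay]; split; [apply: QF_mul | apply: rpredM]. Qed.

Lemma OK_conj x : OK D x -> OK D x^*.
Proof. by move=> [Kx Ax]; split; [apply: QF_conj | rewrite Aint_aut]. Qed.

Lemma OK_ratr (q : rat) : OK D (CQ q) -> exists m : int, q = m%:~R.
Proof.
move=> [_ qA]; have /intrP [m e] := Cint_rat_Aint (Crat_rat q) qA.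
by exists m; apply: CQ_inj; rewrite e ratr_int.
Qed.

Lemma nrm_OK x : OK D x -> exists n : nat, nrm x = n%:R.
Proof.
move=> Ox; have [m mE] : exists m : int, nrm x = m%:~R.
  apply: OK_ratr; rewrite (nrmE D) //; last by case: Ox.
  by apply: OK_mul => //; apply: OK_conj.
have : 0 <= nrm x by apply: (nrm_ge0 D) => //; case: Ox.
rewrite mE ler0z => m0; exists `|m|%N.
by rewrite -[in LHS](gez0_abs m0).
Qed.

Lemma frac_ideal_QF I x : frac_ideal D I -> I x -> QF D x.
Proof. by case=> -[h _ _ _ _] _; apply: h. Qed.

Lemma frac_ideal0 I : frac_ideal D I -> I 0.
Proof. by case=> -[]. Qed.

Lemma frac_idealD I x y : frac_ideal D I -> I x -> I y -> I (x + y).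
Proof. by case=> -[_ _ _ h _] _; apply: h. Qed.

Lemma frac_idealM I r x : frac_ideal D I -> OK D r -> I x -> I (r * x).
Proof. by case=> -[_ _ _ _ h] _; apply: h. Qed.

Lemma frac_idealZ I (m : int) x : frac_ideal D I -> I x -> I (m%:~R * x).
Proof. by move=> fI; apply: frac_idealM fI _; apply: OK_int. Qed.

Lemma frac_idealN I x : frac_ideal D I -> I x -> I (- x).
Proof. by move=> fI Ix; rewrite -mulN1r; apply: (frac_idealZ _ (-1)). Qed.

Lemma frac_ideal_nz I : frac_ideal D I -> exists x, I x /\ x != 0.
Proof. by case=> -[_ _ h _ _] _. Qed.

Lemma int_ideal_frac C : int_ideal D C -> frac_ideal D C.
Proof.
move=> [CO C0 nz CD CM]; split.
  by split=> // x /CO [].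
by exists 1; split=> [||x Cx]; [exact: (OK_int 1) | exact: oner_neq0 | rewrite mul1r; apply: CO].
Qed.

Lemma int_ideal_OK : int_ideal D (OK D).
Proof.
split=> //; [exact: (OK_int 0) | | exact: OK_add | exact: OK_mul].
by exists 1; split; [exact: (OK_int 1) | exact: oner_neq0].
Qed.

Lemma frac_ideal_scale a I :
  QF D a -> a != 0 -> frac_ideal D I -> frac_ideal D (scaleset a I).
Proof.
move=> Ka a0 fI; split.
  split.
  - by move=> _ [w [Iw ->]]; apply: QF_mul => //; apply: frac_ideal_QF fI Iw.
  - by exists 0; rewrite mulr0; split=> //; apply: frac_ideal0 fI.
  - have [x [Ix x0]] := frac_ideal_nz _ fI; exists (a * x); split; last exact: mulf_neq0.
    by exists x.
  - move=> _ _ [x [Ix ->]] [y [Iy ->]]; exists (x + y); rewrite mulrDr.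
    by split=> //; apply: frac_idealD fI _ _.
  - move=> r _ Or [x [Ix ->]]; exists (r * x); rewrite mulrCA.
    by split=> //; apply: frac_idealM fI _ _.
case: fI => _ [d [Od d0 dI]].
(* A denominator of [a] is the product of the denominators of its two rational coordinates on 1,
   [omega]. *)
have [e [Oe e0 Oea]] : exists e, [/\ OK D e, e != 0 & OK D (e * a)].
  have [p [q ->]] := QF_omega D a Ka.
  have qd (t : rat) : CQ t = (numq t)%:~R / (denq t)%:~R by [].
  have dn (t : rat) : (denq t)%:~R != 0 :> algC by rewrite intr_eq0 denq_neq0.
  exists (denq p * denq q)%:~R; split; first exact: OK_int.
    by rewrite intr_eq0 mulf_neq0 ?denq_neq0.
  apply/OK_omega => //; exists (numq p * denq q), (numq q * denq p).
  have := dn p; have := dn q; rewrite (qd p) (qd q) => h1 h2; field.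
  by apply/andP.
exists (e * d); split; [exact: OK_mul | exact: mulf_neq0|].
move=> _ [x [Ix ->]]; have -> : e * d * (a * x) = (e * a) * (d * x) by ring.
by apply: OK_mul => //; apply: dI.
Qed.

Lemma frac_ideal_prod I J :
  frac_ideal D I -> frac_ideal D J -> frac_ideal D (prodset I J).
Proof.
move=> fI fJ; split.
  split.
  - apply: prodset_ind => [||x y Ix Jy]; [exact: (proj1 (OK_int 0)) | exact: QF_add |].
    by apply: QF_mul; [apply: frac_ideal_QF fI Ix | apply: frac_ideal_QF fJ Jy].
  - exact: prodset0.
  - have [x [Ix x0]] := frac_ideal_nz _ fI; have [y [Jy y0]] := frac_ideal_nz _ fJ.
    by exists (x * y); split; [apply: prodset_mul | apply: mulf_neq0].
  - by move=> x y; apply: prodset_add.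
  - move=> r x Or; apply: (prodset_ind I J (fun z => prodset I J (r * z))).
    + by rewrite mulr0; apply: prodset0.
    + by move=> z w; rewrite mulrDr; apply: prodset_add.
    + move=> a b Ia Jb; rewrite mulrA; apply: prodset_mul => //.
      by apply: frac_idealM fI _ _.
case: fI => _ [d [Od d0 dI]]; case: fJ => _ [e [Oe e0 eJ]].
exists (d * e); split; [exact: OK_mul | exact: mulf_neq0|].
apply: prodset_ind => [|z w|x y Ix Jy]; first by rewrite mulr0; apply: (OK_int 0).
  by rewrite mulrDr; apply: OK_add.
by rewrite mulrACA; apply: OK_mul; [apply: dI | apply: eJ].
Qed.

(* Encodes [I * conj I = r O]; as [1] is a combination of the [x y^* / r], it is
   enough to have [r] itself in the product. *)
Definition isnorm (I : algC -> Prop) (r : rat) : Prop :=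
  [/\ 0 < r, forall x y, I x -> I y -> OK D (x * y^* / CQ r)
    & prodset I (fun z => I z^*) (CQ r)].

Lemma CQ_neq0 (r : rat) : 0 < r -> CQ r != 0.
Proof. by move=> r0; rewrite fmorph_eq0 gt_eqF. Qed.

Lemma isnorm_scale a I r : QF D a -> a != 0 ->
  isnorm I r -> isnorm (scaleset a I) (nrm a * r).
Proof.
move=> Ka a0 [r0 Ir rI]; have na0 : 0 < nrm a by rewrite (nrm_gt0 D).
have na := nrmE D D_gt0 a Ka.
have ac0 : a^* != 0 by rewrite conjC_eq0.
have rn0 := CQ_neq0 _ r0.
split; first exact: mulr_gt0.
  move=> _ _ [x [Ix ->]] [y [Iy ->]]; rewrite (rmorphM CQ) /= na rmorphM /=.
  suff -> : a * x * (a^* * y^*) / (a * a^* * CQ r) = x * y^* / CQ r by apply: Ir.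
  by field; rewrite ?a0 ?ac0 ?rn0.
rewrite (rmorphM CQ) /= na; move: rI.
apply: (prodset_ind _ _ (fun z => prodset _ _ (a * a^* * z))).
- by rewrite mulr0; apply: prodset0.
- by move=> z w; rewrite mulrDr; apply: prodset_add.
- move=> x y Ix Iy; rewrite mulrACA; apply: prodset_mul; first by exists x.
  by exists y^*; rewrite rmorphM /= conjCK.
Qed.

Lemma isnorm_prod I J r r' :
  isnorm I r -> isnorm J r' -> isnorm (prodset I J) (r * r').
Proof.
move=> [r0 Ir rI] [r'0 Jr rJ]; have rn0 := CQ_neq0 _ r0; have r'n0 := CQ_neq0 _ r'0.
split; first exact: mulr_gt0.
  move=> x y IJx IJy; rewrite (rmorphM CQ) /=; move: x IJx; apply: prodset_ind.
  - by rewrite !mul0r; apply: (OK_int 0).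
  - by move=> z w hz hw; rewrite !mulrDl; apply: OK_add.
  move=> x1 x2 Ix1 Jx2; move: y IJy; apply: prodset_ind.
  - by rewrite rmorph0 mulr0 mul0r; apply: (OK_int 0).
  - by move=> z w hz hw; rewrite rmorphD /= mulrDr mulrDl; apply: OK_add.
  move=> y1 y2 Iy1 Jy2; rewrite rmorphM /=.
  have -> : x1 * x2 * (y1^* * y2^*) / (CQ r * CQ r')
     = (x1 * y1^* / CQ r) * (x2 * y2^* / CQ r') by field; rewrite ?rn0 ?r'n0.
  by apply: OK_mul; [apply: Ir | apply: Jr].
rewrite (rmorphM CQ) /=; move: rI.
apply: (prodset_ind _ _ (fun z => prodset _ _ (z * CQ r'))).
- by rewrite mul0r; apply: prodset0.
- by move=> z w; rewrite mulrDl; apply: prodset_add.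
move=> x1 x2 Ix1 Ix2; move: rJ.
apply: (prodset_ind _ _ (fun z => prodset _ _ (x1 * x2 * z))).
- by rewrite mulr0; apply: prodset0.
- by move=> z w; rewrite mulrDr; apply: prodset_add.
move=> y1 y2 Jy1 Jy2; rewrite mulrACA; apply: prodset_mul; first exact: prodset_mul.
by rewrite rmorphM /=; apply: prodset_mul.
Qed.

(** [r] is a sum of products of elements of [I] with conjugates of elements of [I], and each such
    product becomes integral when divided by [r']. So [r / r'] is a rational algebraic integer. *)
Lemma isnorm_ratio I r r' :
  isnorm I r -> isnorm I r' -> exists m : int, r / r' = m%:~R.
Proof.
move=> [r0 _ rI] [r'0 Ir' _]; apply: OK_ratr; rewrite (fmorph_div CQ) /=.
move: rI; apply: (prodset_ind _ _ (fun z => OK D (z / CQ r'))).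
- by rewrite mul0r; apply: (OK_int 0).
- by move=> z w; rewrite mulrDl; apply: OK_add.
- by move=> x y Ix Iy; have := Ir' _ _ Ix Iy; rewrite conjCK.
Qed.

(** The two quotients are positive integers with product 1. *)
Lemma isnorm_unique I r r' : isnorm I r -> isnorm I r' -> r = r'.
Proof.
move=> nr nr'; have [r0 _ _] := nr; have [r'0 _ _] := nr'.
have [m mE] := isnorm_ratio _ _ _ nr nr'; have [n nE] := isnorm_ratio _ _ _ nr' nr.
have m_gt0 : 0 < m by rewrite -(ltr0z rat) -mE divr_gt0.
have n_gt0 : 0 < n by rewrite -(ltr0z rat) -nE divr_gt0.
have mn : m * n = 1.
  apply: (intr_inj (R := rat)); rewrite rmorphM /= -mE -nE rmorph1.
  by field; rewrite !gt_eqF.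
have m1 : m = 1 by nia.
by apply/divr1_eq; rewrite mE m1.
Qed.

(** The inverse of [I] is its conjugate divided by [r]. For the direct implication, expand [r] as a
    sum of [x * y] with [x] and the conjugate of [y] in [I]; each [z * x] is integral, so each
    conjugate of [z * x * y] lies in [I]. *)
Lemma finvE I r z : frac_ideal D I -> isnorm I r -> QF D z ->
  Defs.finv D I z <-> I (CQ r * z^*).
Proof.
move=> fI [r0 Ir rI] Kz; have rn0 := CQ_neq0 _ r0; split=> [[_ zI]|Iz].
  have {1}-> : CQ r = (CQ r)^* by rewrite conj_ratr.
  rewrite -(rmorphM Num.conj) /=.
  move: rI; apply: (prodset_ind _ _ (fun w => I (w * z)^*)).
  - by rewrite mul0r rmorph0; apply: frac_ideal0 fI.
  - by move=> v w hv hw; rewrite mulrDl rmorphD; apply: frac_idealD fI _ _.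
  - move=> x y Ix Iy; have -> : x * y * z = z * x * y by ring.
    rewrite rmorphM; apply: frac_idealM fI _ _ => //.
    by apply: OK_conj; apply: zI.
split=> // w Iw; have := Ir _ _ Iw Iz; rewrite (rmorphM Num.conj) /= conj_ratr conjCK.
by have -> : w * (CQ r * z) / CQ r = z * w by field.
Qed.

Lemma isnorm_finv I r : frac_ideal D I -> isnorm I r -> isnorm (Defs.finv D I) r^-1.
Proof.
move=> fI nI; have [r0 Ir rI] := nI; have rn0 := CQ_neq0 _ r0.
split; first by rewrite invr_gt0.
  move=> x y fx fy; rewrite (fmorphV CQ) /= invrK.
  have Ix : I (CQ r * x^*) by apply/(finvE _ _ _ fI nI) => //; case: fx.
  have Iy : I (CQ r * y^*) by apply/(finvE _ _ _ fI nI) => //; case: fy.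
  have := Ir _ _ Iy Ix; rewrite (rmorphM Num.conj) /= conj_ratr conjCK.
  by have -> : CQ r * y^* * (CQ r * x) / CQ r = x * y^* * CQ r by field.
(* Dividing an expression of [r] as a sum of [x * y] by [r ^+ 2] gives one of [r^-1] as a sum of
   [(y / r) * (x / r)], whose factors come from the inverse ideal and its conjugate. *)
have -> : CQ r^-1 = CQ r / CQ r ^+ 2 by rewrite (fmorphV CQ) /=; field.
have fin x : I x -> Defs.finv D I (x^* / CQ r).
  move=> Ix; apply/(finvE _ _ _ fI nI).
    apply: QF_mul; first by apply: QF_conj => //; apply: frac_ideal_QF fI Ix.
    by rewrite -(fmorphV CQ); apply: QF_rat.
  rewrite (fmorph_div Num.conj) /= conj_ratr conjCK.
  by have -> : CQ r * (x / CQ r) = x by field.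
move: rI; apply: (prodset_ind _ _ (fun z => prodset _ _ (z / CQ r ^+ 2))).
- by rewrite mul0r; apply: prodset0.
- by move=> z w; rewrite mulrDl; apply: prodset_add.
move=> x y Ix Iy.
have -> : x * y / CQ r ^+ 2 = (y / CQ r) * (x / CQ r) by field.
apply: prodset_mul; first by have := fin _ Iy; rewrite conjCK.
by rewrite (fmorph_div Num.conj) /= conj_ratr; apply: fin.
Qed.

End Ideals.

(** * The norm form attached to a basis of an ideal *)

(** Spanning only; linear independence is the separate condition [qfree]. *)
Definition zbasis (I : algC -> Prop) (a b : algC) : Prop :=
  forall z, I z <-> exists x y : int, z = x%:~R * a + y%:~R * b.

Definition qfree (a b : algC) : Prop :=
  forall x y : rat, CQ x * a + CQ y * b = 0 -> x = 0 /\ y = 0.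

(* [r * (A x^2 + B x y + C y^2)] is the norm of [x a + y b]. *)
Definition norm_form (D : nat) I a b (A B C : int) (r : rat) : Prop :=
  [/\ isnorm D I r, nrm a = r * A%:~R, trc a b = r * B%:~R, nrm b = r * C%:~R
    & 4 * A * C - B ^+ 2 = absdisc D].

Section Basis.
Variables (D : nat) (D_gt0 : (0 < D)%N) (sqD : squarefree D).
Local Notation w := (omega D).

(* The discriminant is fundamental, so forms of that discriminant are primitive. *)
Lemma form_primitive (A B C : int) : 4 * A * C - B ^+ 2 = absdisc D ->
  exists u v t : int, u * A + v * B + t * C = 1.
Proof.
move=> dE; have [u [v uv]] := Bezoutz A B.
have [k [t kt]] := Bezoutz (gcdz A B) C.
suff g1 : gcdz (gcdz A B) C = 1.
  by exists (k * u), (k * v), t; rewrite -g1 -kt -uv; ring.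
have gA : (gcdz (gcdz A B) C %| A)%Z by rewrite (dvdz_trans (dvdz_gcdl _ _)) ?dvdz_gcdl.
have gB : (gcdz (gcdz A B) C %| B)%Z by rewrite (dvdz_trans (dvdz_gcdl _ _)) ?dvdz_gcdr.
have gC : (gcdz (gcdz A B) C %| C)%Z by rewrite dvdz_gcdr.
have g0 : 0 <= gcdz (gcdz A B) C by [].
move: (gcdz _ C) gA gB gC g0 {k t kt u v uv} => g gA gB gC g0.
have D4 : (D %% 4 != 0)%N.
  by have := sqD 2 isT; apply: contraNN => /eqP d0; lia.
have [g_le1|g_gt1] := leP `|g|%N 1%N.
  have [//|gz] : g = 1 \/ g = 0 by lia.
  move: gA gB gC; rewrite gz !dvd0z => /eqP A0 /eqP B0 /eqP C0.
  by have := absdisc_gt0 D D_gt0; rewrite -dE A0 B0 C0 expr0n.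
have pp := pdiv_prime g_gt1; have pg : ((pdiv `|g|)%:Z %| g)%Z by apply: pdiv_dvd.
have /negP := sqD _ pp; case; move: (pdiv _) pp pg => p pp pg.
have [A' eA] := dvdzP (dvdz_trans pg gA); have [B' eB] := dvdzP (dvdz_trans pg gB).
have [C' eC] := dvdzP (dvdz_trans pg gC).
have e : absdisc D = (4 * A' * C' - B' ^+ 2) * (p * p)%N%:Z.
  by rewrite -dE eA eB eC PoszM; ring.
move: e; rewrite /absdisc; case: eqP => D3 e.
  have : ((p * p)%N%:Z %| D%:Z)%Z by apply/dvdzP; exists (4 * A' * C' - B' ^+ 2).
  by [].
have pp4 : (p * p %| 4 * D)%N.
  have : ((p * p)%N%:Z %| (4 * D)%N%:Z)%Z by apply/dvdzP; exists (4 * A' * C' - B' ^+ 2).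
  by [].
have [p2|p_odd] := even_prime pp; last first.
  move: pp4; rewrite Gauss_dvdr // -[4%N]/(2 ^ 2)%N mulnn coprimeXl // coprimeXr //.
  by rewrite coprimen2.
(* For [p = 2] the divisibility of [4 * D] by 4 says nothing. Instead [D = 4 A' C' - B'^2] would be
   0 or 3 modulo 4, the first excluded by squarefreeness and the second by the present case. *)
move: e; rewrite p2 => e; exfalso.
have De : D%:Z = 4 * A' * C' - B' ^+ 2.
  by move: (4 * A' * C' - _) e => X e; clear -e; lia.
have [i [j [ij Bi]]] := int_parity B'.
move: De; rewrite Bi; case: ij => -> De.
  have : D%:Z = 4 * (A' * C' - i ^+ 2) by rewrite De; ring.
  by move: (_ - i ^+ 2) => X e'; clear -e' D4; lia.
have : D%:Z = 4 * (A' * C' - i ^+ 2 - i - 1) + 3 by rewrite De; ring.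
by move: (_ - 1) => X e'; clear -e' D3; lia.
Qed.

(** The form is read off the matrix of multiplication by [omega]: [b / a = (omega - p) / q], and
    comparing trace and determinant of the matrix with those of [omega] gives the products of [a],
    [b] and their conjugates as well as the discriminant. The orientation [0 < q] makes the scaling
    factor positive. *)
Lemma basis_form_oriented I a b (p q p' q' : int) :
  frac_ideal D I -> zbasis I a b -> qfree a b ->
  w * a = p%:~R * a + q%:~R * b -> w * b = p'%:~R * a + q'%:~R * b -> 0 < q ->
  norm_form D I a b q (q' - p) (- p') (nrm a / q%:~R).
Proof.
move=> fI bI free_ab wa wb q0.
have Ia : I a by apply/bI; exists 1, 0; rewrite mul1r mul0r addr0.
have Ib : I b by apply/bI; exists 0, 1; rewrite mul1r mul0r add0r.
have Ka : QF D a := frac_ideal_QF D _ _ fI Ia; have Kb : QF D b := frac_ideal_QF D _ _ fI Ib.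
have a0 : a != 0.
  apply/eqP => a0; have [] // := free_ab 1 0.
  by rewrite a0 mulr0 rmorph0 mul0r addr0.
have qn0 : q%:~R != 0 :> algC by rewrite intr_eq0 gt_eqF.
have qr0 : (0 : rat) < q%:~R by rewrite ltr0z.
have na0 : 0 < nrm a by rewrite (nrm_gt0 D).
set r := nrm a / q%:~R.
have r0 : 0 < r by rewrite divr_gt0.
have rn0 := CQ_neq0 _ r0.
have rE : CQ r * q%:~R = a * a^*.
  rewrite -(nrmE D) // /r (fmorph_div CQ) /= ratr_int.
  by rewrite mulfVK.
have bE : b = (w - p%:~R) / q%:~R * a.
  apply: (mulfI qn0); rewrite mulrA mulrCA mulfV // mulr1 mulrBl wa; ring.
(* The characteristic polynomial of the matrix and the minimal polynomial of [omega] both annihilate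
   [a]; their difference is linear in [omega], so its coefficients vanish. *)
have tn : (omega_tr D - p - q' = 0) /\ (p * q' - p' * q - omega_nrm D = 0).
  have : (p * q' - p' * q - omega_nrm D)%:~R + (omega_tr D - p - q')%:~R * w = 0.
    apply: (mulIf a0); rewrite mul0r.
    have -> : ((p * q' - p' * q - omega_nrm D)%:~R + (omega_tr D - p - q')%:~R * w) * a
     = (omega_tr D)%:~R * w * a - (omega_nrm D)%:~R * a - p%:~R * (w * a)
       + q'%:~R * (p%:~R * a - w * a) - p'%:~R * q%:~R * a by ring.
    have -> : p%:~R * a - w * a = - (q%:~R * b) by rewrite wa; ring.
    have -> : (omega_tr D)%:~R * w * a - (omega_nrm D)%:~R * a = w * (w * a).
      transitivity (w ^+ 2 * a); last by rewrite expr2 mulrA.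
      by rewrite omega_sqr //; ring.
    have -> : w * (w * a) = p%:~R * (w * a) + q%:~R * (w * b) by rewrite {1}wa; ring.
    by rewrite wb; ring.
  by move/(int_omega_inj D D_gt0) => [].
case: tn => tE nE.
have qp' : q%:~R * p'%:~R = p%:~R * q'%:~R - (omega_nrm D)%:~R :> algC.
  have -> : omega_nrm D = p * q' - p' * q by lia.
  by ring.
have cw : w^* = p%:~R + q'%:~R - w.
  rewrite omega_conj //; have -> : omega_tr D = p + q' by lia.
  by ring.
have ab : b * a^* = CQ r * (w - p%:~R).
  rewrite bE; transitivity ((w - p%:~R) / q%:~R * (a * a^*)); first by ring.
  by rewrite -rE; field.
have ba : a * b^* = CQ r * (q'%:~R - w).
  transitivity ((b * a^*)^*); first by rewrite rmorphM /= conjCK mulrC.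
  rewrite ab rmorphM /= conj_ratr rmorphB /= cw rmorph_int; ring.
have bb : b * b^* = CQ r * (- p')%:~R.
  rewrite {1}bE; transitivity ((w - p%:~R) / q%:~R * (a * b^*)); first by ring.
  rewrite ba; apply: (mulfI qn0).
  transitivity (CQ r * (- (w ^+ 2) + (p%:~R + q'%:~R) * w - p%:~R * q'%:~R)); first by field.
  rewrite omega_sqr //; have -> : omega_tr D = p + q' by lia.
  have -> : q%:~R * (CQ r * (- p')%:~R) = - (CQ r * (q%:~R * p'%:~R)) by ring.
  by rewrite qp'; ring.
have dE : 4 * q * (- p') - (q' - p) ^+ 2 = absdisc D.
  rewrite absdiscE //; have -> : omega_nrm D = p * q' - p' * q by lia.
  have -> : omega_tr D = p + q' by lia.
  by ring.
have rq : CQ (trc a b) = CQ r * (q' - p)%:~R.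
  rewrite (trcE D) // ba [a^* * b]mulrC ab; ring.
split=> //; last 3 first.
- by rewrite /r mulfVK // gt_eqF.
- by apply: CQ_inj; rewrite rq -(ratr_int algC) -(rmorphM CQ).
- by apply: CQ_inj; rewrite (nrmE D) // bb -(ratr_int algC) -(rmorphM CQ).
have Ow : OK D w by apply/OK_omega => //; exists 0, 1; rewrite mul1r add0r.
split=> //.
  move=> x y /bI [x1 [x2 ->]] /bI [y1 [y2 ->]].
  have -> : (x1%:~R * a + x2%:~R * b) * (y1%:~R * a + y2%:~R * b)^* / CQ r
    = (x1 * y1 * q)%:~R + (x2 * y1)%:~R * (w - p%:~R)
      + (x1 * y2)%:~R * (q'%:~R - w) + (x2 * y2)%:~R * (- p')%:~R.
    have -> : (y1%:~R * a + y2%:~R * b)^* = y1%:~R * a^* + y2%:~R * b^*.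
      by rewrite (rmorphD Num.conj) 2!(rmorphM Num.conj) /= 2!(rmorph_int Num.conj).
    transitivity ((x1%:~R * y1%:~R * (a * a^*) + x2%:~R * y1%:~R * (b * a^*)
      + x1%:~R * y2%:~R * (a * b^*) + x2%:~R * y2%:~R * (b * b^*)) / CQ r); first by ring.
    by rewrite -rE ab ba bb; field.
  by do ![apply: OK_add | apply: OK_mul | apply: OK_opp | apply: OK_int | exact: Ow].
(* Primitivity gives a Bezout relation between the coefficients of the form; multiplied by [r], it
   writes [r] as a combination of products of basis elements and their conjugates. *)
have [u [v [t uvt]]] := form_primitive _ _ _ dE.
have -> : CQ r = (u%:~R * a) * a^* + (v%:~R * a) * b^* + (v%:~R * b) * a^* + (t%:~R * b) * b^*.
  transitivity (CQ r * (u * q + v * (q' - p) + t * (- p'))%:~R); first by rewrite uvt mulr1.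
  transitivity (u%:~R * (CQ r * q%:~R) + v%:~R * (CQ r * (q'%:~R - w)) +
     v%:~R * (CQ r * (w - p%:~R)) + t%:~R * (CQ r * (- p')%:~R)); first by ring.
  by rewrite rE -ab -ba -bb; ring.
by do !apply: prodset_add; apply: prodset_mul; rewrite ?conjCK //; apply: (frac_idealZ D).
Qed.

Lemma basis_form I a b : frac_ideal D I -> zbasis I a b -> qfree a b ->
  exists A B C r, norm_form D I a b A B C r.
Proof.
move=> fI bI free_ab.
have Ia : I a by apply/bI; exists 1, 0; rewrite mul1r mul0r addr0.
have Ib : I b by apply/bI; exists 0, 1; rewrite mul1r mul0r add0r.
have Ka : QF D a := frac_ideal_QF D _ _ fI Ia; have Kb : QF D b := frac_ideal_QF D _ _ fI Ib.
have Ow : OK D w by apply/OK_omega => //; exists 0, 1; rewrite mul1r add0r.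
have /bI [p [q wa]] := frac_idealM D _ _ _ fI Ow Ia.
have /bI [p' [q' wb]] := frac_idealM D _ _ _ fI Ow Ib.
have [q0|q0|q0] := ltgtP 0 q.
- by have := basis_form_oriented _ _ _ _ _ _ _ fI bI free_ab wa wb q0; do 4!eexists; eassumption.
(* Replacing [b] by [- b] reverses the orientation and changes the sign of the middle coefficient.
   The remaining case [q = 0] would make [omega] rational. *)
- have := basis_form_oriented I a (- b) p (- q) (- p') q' fI.
  case=> [|||||nI e1 e2 e3 e4]; last first.
  + exists (- q), (- (q' - p)), (- (- p')), (nrm a / (- q)%:~R); split=> //.
    * apply: CQ_inj; rewrite (trcE D) // -[b in LHS]opprK rmorphN /= mulrN [_ * - - b]mulrN -opprD.
      rewrite -(trcE D) //; last exact: QF_opp.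
      by rewrite e2; ring.
    * rewrite -e3; apply: CQ_inj; rewrite !(nrmE D) ?rmorphN ?mulrNN //; exact: QF_opp.
    * by rewrite -e4; ring.
  + by lia.
  + by rewrite mulrN wb; ring.
  + by rewrite wa; ring.
  + move=> x y e; have [] := free_ab x (- y); first by rewrite -e; ring.
    by move=> -> ?; split=> //; lra.
  + move=> z; split=> [/bI [x [y ->]]|[x [y ->]]].
      by exists x, (- y); ring.
    by apply/bI; exists x, (- y); ring.
- have e : CQ (- p%:~R) * a + CQ 1 * (w * a) = 0.
    by rewrite wa -q0 (rmorphN CQ) /= ratr_int (rmorph1 CQ); ring.
  have a0 : a != 0.
    apply/eqP => a0; have [] // := free_ab 1 0.
    by rewrite a0 mulr0 rmorph0 mul0r addr0.
  have : CQ (- p%:~R) + CQ 1 * w = 0 by apply: (mulIf a0); rewrite mul0r -e; ring.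
  by move/(ratr_omega_inj D D_gt0) => [_ /eqP]; rewrite oner_eq0.
Qed.

End Basis.

(** * Reduced bases, and the norm of an integral ideal as its index *)

Lemma nat_min (P : nat -> Prop) :
  (exists n, P n) -> exists n, P n /\ forall m, P m -> (n <= m)%N.
Proof.
move=> [n]; elim/ltn_ind: n => n IH Pn.
have [[m [mn Pm]]|h] := classic (exists m, (m < n)%N /\ P m); first exact: IH mn Pm.
exists n; split=> // m Pm; rewrite leqNgt; apply/negP => mn.
by apply: h; exists m.
Qed.

Lemma small_multiple (x : int) (d u v : nat) :
  (u < d)%N -> (v < d)%N -> u%:Z - v%:Z - x * d%:Z = 0 -> x = 0.
Proof.
move=> ud vd e; have [x0|x0|//] := ltgtP x 0; exfalso; nia.
Qed.

Lemma round_rat (q : rat) : exists n : int, - (1 / 2) <= q - n%:~R <= 1 / 2.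
Proof.
exists (Num.floor (q + 1 / 2)).
have := floor_itv (q + 1 / 2); rewrite rmorphD /=; lra.
Qed.

(** The three terms are at most [A / 4], [A / 4] and [C / 4]. *)
Lemma round_form_bound (A T C x y : rat) :
  - A <= T -> T <= A -> - (1 / 2) <= x <= 1 / 2 -> - (1 / 2) <= y <= 1 / 2 ->
  0 <= A -> 0 <= C -> x ^+ 2 * A + x * y * T + y ^+ 2 * C <= (2 * A + C) / 4.
Proof.
move=> T1 T2 xb yb A0 C0.
have x2 : 0 <= (1 / 4 - x ^+ 2) by nra.
have y2 : 0 <= (1 / 4 - y ^+ 2) by nra.
have xy1 : 0 <= 1 / 4 - x * y by nra.
have xy2 : 0 <= 1 / 4 + x * y by nra.
have h1 := mulr_ge0 x2 A0; have h2 := mulr_ge0 y2 C0.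
have p1 : 0 <= A + T by lra.
have p2 : 0 <= A - T by lra.
have h3 := mulr_ge0 xy1 p1; have h4 := mulr_ge0 xy2 p2.
nra.
Qed.

Section Reduction.
Variables (D : nat) (D_gt0 : (0 < D)%N) (sqD : squarefree D).
Local Notation w := (omega D).

Lemma OK_w : OK D w.
Proof. by apply/OK_omega => //; exists 0, 1; rewrite mul1r add0r. Qed.

(** After multiplication by a common denominator [d] of [I] the norms are natural numbers, where a
    minimum exists. *)
Lemma nrm_min I (P : algC -> Prop) : frac_ideal D I -> (forall z, P z -> I z) ->
  (exists z, P z) -> exists z, P z /\ forall y, P y -> nrm z <= nrm y.
Proof.
move=> fI PI [z0 Pz0]; have [_ [d [Od d0 dI]]] := fI.
have Kd : QF D d by case: Od.
have nd z : P z -> nrm (d * z) = nrm d * nrm z.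
  by move=> /PI Iz; rewrite (nrmM D) //; apply: frac_ideal_QF fI Iz.
have [|n [[z [Pz zn]] n_min]] := nat_min (fun n => exists z, P z /\ nrm (d * z) = n%:R).
  have [n nE] := nrm_OK D D_gt0 _ (dI _ (PI _ Pz0)).
  by exists n, z0.
exists z; split=> // y Py.
have [m mE] := nrm_OK D D_gt0 _ (dI _ (PI _ Py)).
have : nrm (d * z) <= nrm (d * y) by rewrite zn mE ler_nat n_min //; exists y.
by rewrite !nd // ler_pM2l // (nrm_gt0 D).
Qed.

Lemma qfree_neq0 a b : qfree a b -> a != 0.
Proof.
move=> free_ab; apply/eqP => a0; have [] // := free_ab 1 0.
by rewrite a0 mulr0 rmorph0 mul0r addr0.
Qed.

Lemma qfree_span a b z : QF D a -> QF D b -> qfree a b -> QF D z ->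
  exists x y : rat, z = CQ x * a + CQ y * b.
Proof.
move=> [a1 [a2 aE]] [b1 [b2 bE]] free_ab [z1 [z2 ->]].
have d0 : a1 * b2 - a2 * b1 != 0.
  apply/eqP => d0; have [|b20 /eqP] := free_ab b2 (- a2).
    rewrite aE bE; transitivity (CQ (a1 * b2 - a2 * b1)); first by ring.
    by rewrite d0 rmorph0.
  rewrite oppr_eq0 => /eqP a20.
  have [|b10 /eqP] := free_ab b1 (- a1).
    by rewrite aE bE a20 b20 !rmorph0; ring.
  rewrite oppr_eq0 => /eqP a10.
  by have /eqP := qfree_neq0 _ _ free_ab; rewrite aE a10 a20 !rmorph0; case; ring.
(* Cramer's rule in the coordinates on 1, [s]. *)
exists ((z1 * b2 - z2 * b1) / (a1 * b2 - a2 * b1)).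
exists ((a1 * z2 - a2 * z1) / (a1 * b2 - a2 * b1)).
have d0' : CQ a1 * CQ b2 - CQ a2 * CQ b1 != 0.
  by rewrite -!(rmorphM CQ) -(rmorphB CQ) fmorph_eq0.
rewrite aE bE !(fmorph_div CQ) /= !(rmorphB CQ) /= !(rmorphM CQ) /=.
by field.
Qed.

(** Successive minima: [a] is a shortest nonzero element and [b] a shortest one that is not a
    rational multiple of [a], with its sign chosen to make the trace nonnegative. *)
Lemma minimal_pair I : frac_ideal D I -> exists a b,
  [/\ I a /\ I b, a != 0, forall q : rat, b <> CQ q * a, 0 <= trc a b &
    (forall z, I z -> z != 0 -> nrm a <= nrm z) /\
    (forall z, I z -> (forall q : rat, z <> CQ q * a) -> nrm b <= nrm z)].
Proof.
move=> fI.
have [||a [[Ia a0] amin]] := nrm_min I (fun z => I z /\ z != 0) fI.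
- by move=> z [].
- exact: frac_ideal_nz fI.
have Ka : QF D a := frac_ideal_QF D _ _ fI Ia.
have [||b [[Ib bq] bmin]] :=
    nrm_min I (fun z => I z /\ forall q : rat, z <> CQ q * a) fI.
- by move=> z [].
(* Irrationality of [omega] gives an element of [I] off the line of [a]. *)
- exists (w * a); split; first by apply: frac_idealM fI OK_w Ia.
  move=> q /(mulIf a0) wq; have := ratr_omega_inj D D_gt0 (- q) 1.
  rewrite wq rmorphN rmorph1 mul1r addNr => /(_ erefl) [_ /eqP].
  by rewrite oner_eq0.
have Kb : QF D b := frac_ideal_QF D _ _ fI Ib.
have [t0|t0] := leP 0 (trc a b).
  by exists a, b; split=> //; split=> z; [move=> Iz z0; apply: amin | move=> Iz h; apply: bmin].
have nb : nrm (- b) = nrm b by rewrite /nrm rmorphN mulrNN.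
exists a, (- b); split=> //; rewrite ?nb.
- by split=> //; apply: frac_idealN fI Ib.
- by move=> q e; apply: (bq (- q)); rewrite rmorphN mulNr -e opprK.
- have -> : trc a (- b) = - trc a b.
    apply: CQ_inj; rewrite (rmorphN CQ) /= !(trcE D) //; last exact: QF_opp.
    by rewrite rmorphN /=; ring.
  by rewrite oppr_ge0 ltW.
- by split=> z; [move=> Iz z0; apply: amin | move=> Iz h; apply: bmin].
Qed.

(** Lagrange reduction. Comparing [b] with [b - a] gives [trc a b <= nrm a]. To see that [a], [b]
    span, round the coordinates of [z]: the remainder has norm at most
    [(2 nrm a + nrm b) / 4 < nrm b], so it is a multiple of [a], and then it has norm at most
    [nrm a / 4], so it is zero. *)
Lemma reduced_basis I : frac_ideal D I -> exists a b A B C r,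
  [/\ zbasis I a b, qfree a b, norm_form D I a b A B C r & [/\ 0 < A, 0 <= B, B <= A & A <= C]].
Proof.
move=> fI; have [a [b [[Ia Ib] a0 bq t0 [amin bmin]]]] := minimal_pair I fI.
have Ka : QF D a := frac_ideal_QF D _ _ fI Ia; have Kb : QF D b := frac_ideal_QF D _ _ fI Ib.
have b0 : b != 0 by apply/eqP => b0; apply: (bq 0); rewrite b0 rmorph0 mul0r.
have free_ab : qfree a b.
  move=> x y e; have [y0|y0] := eqVneq y 0.
    split=> //; move: e; rewrite y0 rmorph0 mul0r addr0 => /eqP.
    by rewrite mulf_eq0 (negbTE a0) orbF fmorph_eq0 => /eqP.
  case: (bq (- x / y)); have yn0 : CQ y != 0 by rewrite fmorph_eq0.
  apply: (mulfI yn0); rewrite (fmorph_div CQ) /= (rmorphN CQ) /=.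
  transitivity (- (CQ x * a)); last by field.
  by apply/eqP; rewrite -addr_eq0 addrC e.
have nab : nrm a <= nrm b by apply: amin.
have na0 : 0 < nrm a by rewrite (nrm_gt0 D).
have tab : trc a b <= nrm a.
  have : nrm b <= nrm (b - a).
    apply: bmin; first by apply: (frac_idealD D _ _ _ fI Ib); apply: frac_idealN fI Ia.
    move=> q e; apply: (bq (q + 1)); rewrite rmorphD rmorph1 mulrDl -e mul1r.
    by rewrite subrK.
  have -> : b - a = CQ (-1) * a + CQ 1 * b by rewrite rmorphN rmorph1; ring.
  by rewrite (nrm_comb D) //; lra.
have bI : zbasis I a b.
  move=> z; split=> [Iz|[x [y ->]]]; last first.
    by apply: (frac_idealD D _ _ _ fI); apply: (frac_idealZ D _ _ _ fI).
  have [x [y zE]] := qfree_span _ _ _ Ka Kb free_ab (frac_ideal_QF D _ _ fI Iz).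
  have [n xn] := round_rat x; have [m ym] := round_rat y.
  have zE' : z = CQ (x - n%:~R) * a + CQ (y - m%:~R) * b + (n%:~R * a + m%:~R * b).
    by rewrite zE; ring.
  set z' := CQ (x - n%:~R) * a + CQ (y - m%:~R) * b in zE'.
  have Iz' : I z'.
    have -> : z' = z + ((- n)%:~R * a + (- m)%:~R * b) by rewrite zE'; ring.
    by do !apply: (frac_idealD D _ _ _ fI) => //; apply: (frac_idealZ D _ _ _ fI).
  have nz' : nrm z' <= (2 * nrm a + nrm b) / 4.
    by rewrite (nrm_comb D) //; apply: round_form_bound => //; lra.
  have y0 : y - m%:~R = 0.
    apply/eqP; apply/negPn/negP => y0.
    have : nrm b <= nrm z'.
      apply: bmin => // q e; have [] := free_ab (x - n%:~R - q) (y - m%:~R); last first.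
        by move=> _ /eqP; rewrite (negbTE y0).
      by rewrite (rmorphB CQ _ q) mulrBl -e /z'; ring.
    by lra.
  have x0 : x - n%:~R = 0.
    apply/eqP; apply/negPn/negP => x0.
    have : nrm a <= nrm z'.
      apply: amin => //; rewrite /z' y0 rmorph0 mul0r addr0.
      by rewrite mulf_neq0 // fmorph_eq0.
    rewrite (nrm_comb D) // y0; have : (x - n%:~R) ^+ 2 <= 1 / 4 by nra.
    by nra.
  exists n, m; rewrite zE' /z' x0 y0 rmorph0; ring.
have [A [B [C [r nf]]]] := basis_form D D_gt0 sqD I a b fI bI free_ab.
exists a, b, A, B, C, r; split=> //.
have [[r0 _ _] e1 e2 e3 _] := nf; move: na0 t0 tab nab; rewrite e1 e2 e3.
by rewrite pmulr_rgt0 // pmulr_rge0 // !ler_pM2l // ltr0z ler0z !ler_int.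
Qed.

Lemma isnorm_exists I : frac_ideal D I -> exists r, isnorm D I r.
Proof.
by move=> fI; have [a [b [A [B [C [r [_ _ [nI _ _ _ _] _]]]]]]] := reduced_basis I fI; exists r.
Qed.

(** Hermite normal form: [a] is the least positive integer in [J] and [k] the least positive
    [omega]-coordinate of an element; division with remainder gives spanning. *)
Lemma hermite_basis J : int_ideal D J -> exists (a k : nat) (b : int),
  [/\ (0 < a)%N, (0 < k)%N & zbasis J a%:R (b%:~R + k%:R * w)].
Proof.
move=> iJ; have fJ := int_ideal_frac D _ iJ; have [JO J0 [x [Jx x0]] JD JM] := iJ.
have Kx : QF D x := frac_ideal_QF D _ _ fJ Jx.
(* The norm of a nonzero element of [J] is a positive integer in [J]. *)
have [|a [[a0 Ja] a_min]] := nat_min (fun n => (0 < n)%N /\ J n%:R).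
  have [n nE] := nrm_OK D D_gt0 _ (JO _ Jx); exists n; split.
    by rewrite -(ltr_nat rat) -nE (nrm_gt0 D).
  have -> : n%:R = x^* * x.
    by rewrite mulrC -(nrmE D D_gt0 x Kx) nE rmorph_nat.
  by apply: JM => //; apply: OK_conj => //; apply: JO.
have [|k [[k0 [b Jb]] k_min]] :=
    nat_min (fun n => (0 < n)%N /\ exists x : int, J (x%:~R + n%:R * w)).
  exists a; split=> //; exists 0; rewrite add0r mulrC; apply: JM => //; exact: OK_w.
exists a, k, b; split=> // z; split=> [Jz|[m [n ->]]]; last first.
  by apply: JD; apply: JM => //; apply: OK_int.
have /(OK_omega D D_gt0 sqD) [u [v zE]] := JO _ Jz.
pose y := (v %/ k%:Z)%Z; pose v' := (v %% k%:Z)%Z.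
have vE : v = y * k%:Z + v' by apply: divz_eq.
have v'0 : 0 <= v' by apply: modz_ge0; lia.
have v'k : v' < k%:Z by apply: ltz_pmod; lia.
have Jz' : J ((u - y * b)%:~R + v'%:~R * w).
  have -> : (u - y * b)%:~R + v'%:~R * w = z + (- y)%:~R * (b%:~R + k%:R * w).
    by rewrite zE {1}vE; ring.
  by apply: JD => //; apply: JM => //; apply: OK_int.
have v'z : v' = 0.
  apply/eqP; apply/negPn/negP => v'n.
  have : (k <= `|v'|)%N.
    apply: k_min; split; first by lia.
    exists (u - y * b); have -> : `|v'|%N%:R = v'%:~R :> algC by rewrite -[in RHS](gez0_abs v'0).
    by [].
  by lia.
pose m := ((u - y * b) %/ a%:Z)%Z; pose u' := ((u - y * b) %% a%:Z)%Z.
have uE : u - y * b = m * a%:Z + u' by apply: divz_eq.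
have u'0 : 0 <= u' by apply: modz_ge0; lia.
have u'a : u' < a%:Z by apply: ltz_pmod; lia.
have Ju' : J u'%:~R.
  have -> : u'%:~R = ((u - y * b)%:~R + v'%:~R * w) + (- m)%:~R * a%:R.
    by rewrite v'z uE; ring.
  by apply: JD => //; apply: JM => //; apply: OK_int.
have u'z : u' = 0.
  apply/eqP; apply/negPn/negP => u'n.
  have : (a <= `|u'|)%N.
    apply: a_min; split; first by lia.
    have -> : `|u'|%N%:R = u'%:~R :> algC by rewrite -[in RHS](gez0_abs u'0).
    by [].
  by lia.
exists m, y; rewrite zE vE v'z; have -> : u = m * a%:Z + y * b by lia.
by ring.
Qed.

(** Compute [4 nrm a nrm b - (trc a b)^2] on the Hermite basis in two ways: directly it is
    [(a k)^2 absdisc], from the norm form it is [r^2 absdisc]. Hence [r = a k], the number of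
    classes modulo [J]. *)
Lemma isnorm_index J r : int_ideal D J -> isnorm D J r ->
  exists n : nat, r = n%:R /\ ideal_index D J n.
Proof.
move=> iJ nJ; have fJ := int_ideal_frac D _ iJ.
have [a [k [b [a0 k0 bJ]]]] := hermite_basis J iJ.
have an0 : a%:R != 0 :> rat by rewrite pnatr_eq0 -lt0n.
have kn0 : k%:R != 0 :> rat by rewrite pnatr_eq0 -lt0n.
have wq (x y : rat) : CQ x * a%:R + CQ y * (b%:~R + k%:R * w)
    = CQ (x * a%:R + y * b%:~R) + CQ (y * k%:R) * w by ring.
have Kw := omega_QF D.
have free : qfree a%:R (b%:~R + k%:R * w).
  move=> x y; rewrite wq => /(ratr_omega_inj D D_gt0) [e1 /eqP].
  rewrite mulf_eq0 (negbTE kn0) orbF => /eqP y0; move: e1.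
  by rewrite y0 mul0r addr0 => /eqP; rewrite mulf_eq0 (negbTE an0) orbF => /eqP.
exists (a * k)%N; split.
  have [A [B [C [r' [nJ' e1 e2 e3 e4]]]]] := basis_form D D_gt0 sqD J _ _ fJ bJ free.
  have rr := isnorm_unique D D_gt0 J r r' nJ nJ'; rewrite -{r'}rr in nJ' e1 e2 e3.
  have [r0 _ _] := nJ.
  have Ka : QF D a%:R by rewrite -(rmorph_nat CQ); apply: QF_rat.
  have Kb : QF D (b%:~R + k%:R * w).
    apply: QF_add; first by rewrite -ratr_int; apply: QF_rat.
    by apply: QF_mul => //; rewrite -(rmorph_nat CQ); apply: QF_rat.
  have na : nrm a%:R = a%:R ^+ 2.
    by rewrite -(nrm_rat D D_gt0) rmorph_nat.
  have nb : nrm (b%:~R + k%:R * w)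
     = b%:~R ^+ 2 + b%:~R * k%:R * (omega_tr D)%:~R + k%:R ^+ 2 * (omega_nrm D)%:~R.
    apply: CQ_inj; rewrite (nrmE D) // rmorphD /= rmorphM /= rmorph_int rmorph_nat.
    transitivity (b%:~R ^+ 2 + b%:~R * k%:R * (w + w^*) + k%:R ^+ 2 * (w * w^*)); first by ring.
    by rewrite omega_mul_conj // omega_conj //; ring.
  have tb : trc a%:R (b%:~R + k%:R * w) = a%:R * (2 * b%:~R + k%:R * (omega_tr D)%:~R).
    apply: CQ_inj; rewrite (trcE D) // rmorphD /= rmorphM /= rmorph_int !rmorph_nat.
    by rewrite omega_conj //; ring.
  have e : r ^+ 2 * (absdisc D)%:~R = (a%:R * k%:R) ^+ 2 * (absdisc D)%:~R.
    transitivity (4 * nrm a%:R * nrm (b%:~R + k%:R * w) - trc a%:R (b%:~R + k%:R * w) ^+ 2).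
      by rewrite e1 e2 e3 -e4; ring.
    by rewrite na nb tb absdiscE //; ring.
  have d0 : (absdisc D)%:~R != 0 :> rat by rewrite intr_eq0 gt_eqF // absdisc_gt0.
  have ak0 : 0 <= a%:R * k%:R :> rat by rewrite mulr_ge0 ?ler0n.
  move/(mulIf d0)/eqP: e; rewrite (eqrXn2 _ (ltW r0) ak0) //.
  by rewrite natrM => /eqP.
(* Representatives [u + v omega] with [u < a] and [v < k], numbered by [v a + u]. *)
exists (fun i : 'I_(a * k) => (i %% a)%N%:R + (i %/ a)%N%:R * w); split.
- move=> i; apply/(OK_omega D D_gt0 sqD); exists (i %% a)%N, (i %/ a)%N.
  by [].
- move=> i j /bJ [x [y e]]; apply: val_inj => /=.
  have [e1 e2] : ((i %% a)%N%:Z - (j %% a)%N%:Z - x * a%:Z - y * b = 0)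
      /\ ((i %/ a)%N%:Z - (j %/ a)%N%:Z - y * k%:Z = 0).
    apply: (int_omega_inj D D_gt0).
    transitivity ((i %% a)%N%:R + (i %/ a)%N%:R * w - ((j %% a)%N%:R + (j %/ a)%N%:R * w)
        - (x%:~R * a%:R + y%:~R * (b%:~R + k%:R * w))); first by ring.
    by rewrite e subrr.
  have ik : (i %/ a < k)%N by rewrite ltn_divLR // [(k * a)%N]mulnC.
  have jk : (j %/ a < k)%N by rewrite ltn_divLR // [(k * a)%N]mulnC.
  have ia := ltn_pmod i a0; have ja := ltn_pmod j a0.
  have y0 := small_multiple _ _ _ _ ik jk e2.
  rewrite {}y0 !(mul0r, subr0) in e1 e2.
  have x0 := small_multiple _ _ _ _ ia ja e1.
  rewrite {}x0 !(mul0r, subr0) in e1.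
  have q : (i %/ a = j %/ a)%N by lia.
  have m : (i %% a = j %% a)%N by lia.
  by rewrite (divn_eq i a) (divn_eq j a) q m.
- move=> z /(OK_omega D D_gt0 sqD) [u [v ->]].
  pose y := (v %/ k%:Z)%Z; pose v' := (v %% k%:Z)%Z.
  have vE : v = y * k%:Z + v' by apply: divz_eq.
  have v'0 : 0 <= v' by apply: modz_ge0; lia.
  have v'k : v' < k%:Z by apply: ltz_pmod; lia.
  pose m := ((u - y * b) %/ a%:Z)%Z; pose u' := ((u - y * b) %% a%:Z)%Z.
  have uE : u - y * b = m * a%:Z + u' by apply: divz_eq.
  have u'0 : 0 <= u' by apply: modz_ge0; lia.
  have u'a : u' < a%:Z by apply: ltz_pmod; lia.
  have lt_i : (`|v'| * a + `|u'| < a * k)%N by nia.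
  have ua : (`|u'| < a)%N by lia.
  exists (Ordinal lt_i); apply/bJ; exists m, y => /=.
  rewrite modnMDl modn_small // divnMDl // divn_small // addn0.
  have -> : `|v'|%N%:R = v'%:~R :> algC by rewrite -[in RHS](gez0_abs v'0).
  have -> : `|u'|%N%:R = u'%:~R :> algC by rewrite -[in RHS](gez0_abs u'0).
  have -> : u = m * a%:Z + u' + y * b by lia.
  by rewrite {1}vE; ring.
Qed.

End Reduction.

(** * Covering radius and deep holes of a binary quadratic form *)

Definition qform (A B C x y : rat) : rat := A * x ^+ 2 + B * x * y + C * y ^+ 2.

Section Covering.
Variables (A B C : rat) (A_gt0 : 0 < A) (disc_gt0 : 0 < 4 * A * C - B ^+ 2).
Local Notation Q := (qform A B C).
Local Notation Delta := (4 * A * C - B ^+ 2).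

(* With [(s0, t0)] the circumcentre of the triangle 0, (1,0), (0,1) and [rho] its
   squared circumradius, [s A + t C - Q (s, t) = rho - Q (s - s0, t - t0)]. *)
Lemma power_le_circumradius s t :
  Delta * (s * A + t * C - Q s t) <= A * C * (A + C - B).
Proof.
rewrite -subr_ge0 -(pmulr_rge0 _ A_gt0).
have -> : A * (A * C * (A + C - B) - Delta * (s * A + t * C - Q s t))
  = (Delta * (2 * A * s + B * t - A) ^+ 2 + (Delta * t - A * (2 * C - B)) ^+ 2) / 4.
  by rewrite /qform; field.
by rewrite divr_ge0 // addr_ge0 // ?sqr_ge0 // mulr_ge0 ?sqr_ge0 // ltW.
Qed.

(** The mean of the three values of [Q], weighted by the barycentric coordinates of [(s, t)], is
    [s A + t C - Q s t]. This is at most the squared circumradius, hence below 1, so the three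
    values are not all at least 1. *)
Lemma triangle_cover s t : A * C * (A + C - B) < Delta ->
  0 <= s -> 0 <= t -> s + t <= 1 ->
  [\/ Q s t < 1, Q (s - 1) t < 1 | Q s (t - 1) < 1].
Proof.
move=> rho s0 t0 st.
have [h1|h1] := ltP (Q s t) 1; first by constructor 1.
have [h2|h2] := ltP (Q (s - 1) t) 1; first by constructor 2.
have [h3|h3] := ltP (Q s (t - 1)) 1; first by constructor 3.
exfalso; have := power_le_circumradius s t.
have -> : s * A + t * C - Q s t = (1 - s - t) * Q s t + s * Q (s - 1) t + t * Q s (t - 1).
  by rewrite /qform; ring.
move: (Q s t) (Q (s - 1) t) (Q s (t - 1)) h1 h2 h3 => q1 q2 q3 h1 h2 h3.
have p1 : 0 <= (1 - s - t) * (q1 - 1) by apply: mulr_ge0; lra.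
have p2 : 0 <= s * (q2 - 1) by apply: mulr_ge0; lra.
have p3 : 0 <= t * (q3 - 1) by apply: mulr_ge0; lra.
have : 1 <= (1 - s - t) * q1 + s * q2 + t * q3 by lra.
by rewrite -(ler_pM2l disc_gt0); lra.
Qed.

(** Translate into the unit square, which the diagonal cuts into the triangle of [triangle_cover]
    and its image under a point reflection, a symmetry of [Q]. *)
Lemma plane_cover s t : A * C * (A + C - B) < Delta ->
  exists i j : int, Q (s - i%:~R) (t - j%:~R) < 1.
Proof.
move=> rho; have := floor_itv s; have := floor_itv t.
set n := Num.floor s; set m := Num.floor t; rewrite !rmorphD /= => mt ns.
have [st|st] := leP ((s - n%:~R) + (t - m%:~R)) 1.
  have [|||h|h|h] := triangle_cover (s - n%:~R) (t - m%:~R) rho; try lra.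
  - by exists n, m.
  - by exists (n + 1), m; rewrite rmorphD opprD addrA.
  - by exists n, (m + 1); rewrite rmorphD opprD addrA.
have QN x y : Q (- x) (- y) = Q x y by rewrite /qform; ring.
have [|||h|h|h] := triangle_cover (n%:~R + 1 - s) (m%:~R + 1 - t) rho; try lra.
- exists (n + 1), (m + 1); rewrite -QN !rmorphD /=.
  by congr (Q _ _ < 1): h; ring.
- exists n, (m + 1); rewrite -QN !rmorphD /=.
  by congr (Q _ _ < 1): h; ring.
- exists (n + 1), m; rewrite -QN !rmorphD /=.
  by congr (Q _ _ < 1): h; ring.
Qed.

End Covering.

(** The expression is the excess over the squared circumradius of the distance from the circumcentre
    to [(i, j)]: no lattice point lies inside the circumcircle. If [i j >= 0] every term is
    nonnegative; otherwise replacing [B] and [C] by [A] only decreases it, which leaves [A] times a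
    nonnegative integer. *)
Lemma reduced_corner_ge0 (A B C i j : int) : 0 <= B -> B <= A -> A <= C ->
  0 <= A * i * (i - 1) + B * i * j + C * j * (j - 1).
Proof.
move=> B0 BA AC.
have sq (k : int) : 0 <= k * (k - 1) by nia.
have pos : 0 <= i * j -> 0 <= A * i * (i - 1) + B * i * j + C * j * (j - 1).
  move=> ij; have := mulr_ge0 B0 ij.
  have A0 : 0 <= A by lia.
  have C0 : 0 <= C by lia.
  by have := mulr_ge0 A0 (sq i); have := mulr_ge0 C0 (sq j); lia.
have [ij|ij] := leP 0 (i * j); first exact: pos.
have h : 0 <= i * (i - 1) + i * j + j * (j - 1).
  have [i0|i0] := leP 0 i.
    have j0 : j <= -1 by nia.
    have i1 : 1 <= i by nia.
    have : 0 <= (i + j) ^+ 2 by apply: sqr_ge0.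
    by nia.
  have j1 : 1 <= j by nia.
  have : 0 <= (i + j) ^+ 2 by apply: sqr_ge0.
  by nia.
have A0 : 0 <= A by lia.
have CA : 0 <= C - A by lia.
have AB : 0 <= A - B by lia.
have nij : 0 <= - (i * j) by lia.
have := mulr_ge0 A0 h; have := mulr_ge0 CA (sq j); have := mulr_ge0 AB nij; lia.
Qed.

Lemma circumcentre_hole (A B C : int) : 0 < A -> 0 <= B -> B <= A -> A <= C ->
  let d : rat := (4 * A * C - B ^+ 2)%:~R in
  exists s t : rat, forall i j : int,
    (A * C * (A + C - B))%:~R / d <= qform A%:~R B%:~R C%:~R (s - i%:~R) (t - j%:~R).
Proof.
move=> A0 B0 BA AC d.
have d0 : d != 0.
  have : 0 < 4 * A * C - B ^+ 2 by nia.
  by rewrite /d intr_eq0; lia.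
(* The circumcentre, solution of [2 A s + B t = A] and [B s + 2 C t = C]. *)
exists ((C * (2 * A - B))%:~R / d), ((A * (2 * C - B))%:~R / d) => i j.
rewrite -subr_ge0.
have -> : qform A%:~R B%:~R C%:~R ((C * (2 * A - B))%:~R / d - i%:~R)
    ((A * (2 * C - B))%:~R / d - j%:~R) - (A * C * (A + C - B))%:~R / d
  = (A * i * (i - 1) + B * i * j + C * j * (j - 1))%:~R.
  rewrite /qform; move: d0; rewrite /d => d0; field.
  by move: d0; congr (_ != 0); ring.
by rewrite ler0z; apply: reduced_corner_ge0.
Qed.

(** * Enumeration of reduced forms of small discriminant *)

Section Arithmetic.
Variables (D : nat) (A B C : int).
Hypotheses (A_gt0 : 0 < A) (B_ge0 : 0 <= B) (BA : B <= A) (AC : A <= C).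
Hypothesis discE : 4 * A * C - B ^+ 2 = absdisc D.

(** If [C >= 4], then [A + C - B >= 4], strictly if [B = 0], so the right side exceeds
    [4 A C - B^2]. The finitely many forms with [C <= 3] are inspected; squarefreeness enters there
    through 4 and 9. *)
Lemma circumradius_gt1 : squarefree D -> D \notin [:: 1; 2; 3; 5; 7; 11; 15]%N ->
  absdisc D < A * C * (A + C - B).
Proof.
move=> sqD; rewrite !inE !negb_or => /and5P [d1 d2 d3 d5 /and3P [d7 d11 d15]].
have D4 : (D %% 4 != 0)%N by have := sqD 2 isT; apply: contraNN => /eqP h; lia.
have D9 : (D %% 9 != 0)%N by have := sqD 3 isT; apply: contraNN => /eqP h; lia.
have [C4|C4] := leP 4 C.
  rewrite -discE; have AC0 : 0 < A * C by nia.
  have [b0|b0] := eqVneq B 0; first by rewrite b0; nia.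
  have : A * C * 4 <= A * C * (A + C - B) by rewrite ler_pM2l //; lia.
  by nia.
have hA : A = 1 \/ A = 2 \/ A = 3 by lia.
have hB : B = 0 \/ B = 1 \/ B = 2 \/ B = 3 by lia.
have hC : C = 1 \/ C = 2 \/ C = 3 by lia.
move: discE BA AC; rewrite /absdisc; clear - hA hB hC d1 d2 d3 d5 d7 d11 d15 D4 D9.
by case: hA => [->|[->|->]]; case: hB => [->|[->|[->|->]]];
   case: hC => [->|[->|->]]; case: eqP => h; lia.
Qed.

(** Reduction gives [3 A^2 <= 4 A C - B^2 <= 20]. *)
Lemma reduced_small : absdisc D <= 20 ->
  (A = 1 \/ A = 2) /\ (B = 0 \/ B = 1 \/ B = 2).
Proof.
move=> d20; have : A <= 2 by nia.
by split; lia.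
Qed.

Lemma reduced_h1 : D \in [:: 1; 2; 3; 7; 11]%N ->
  A = 1 /\ A * C * (A + C - B) < absdisc D.
Proof.
rewrite !inE => hD; have d20 : absdisc D <= 20.
  by case/or4P: hD => [/eqP->|/eqP->|/eqP->|/orP[/eqP->|/eqP->]].
have [hA hB] := reduced_small d20; move: discE BA AC.
case/or4P: hD => [/eqP->|/eqP->|/eqP->|/orP[/eqP->|/eqP->]]; rewrite /absdisc /=;
case: hA => ->; case: hB => [->|[->|->]] e1 e2 e3;
first [exfalso; lia | (have -> : C = 1 by lia); split; lia | (have -> : C = 2 by lia); split; lia
 | (have -> : C = 3 by lia); split; lia].
Qed.

(** [A = 1] will mean a principal ideal ([norm_form_principal]), so each of the two fields has
    exactly one other reduced form. *)
Lemma reduced_h2 : D \in [:: 5; 15]%N ->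
  A = 1 \/ [/\ A = 2, B = 2, C = 3 & D = 5%N] \/ [/\ A = 2, B = 1, C = 2 & D = 15%N].
Proof.
rewrite !inE => hD; have d20 : absdisc D <= 20 by case/orP: hD => /eqP->.
have [hA hB] := reduced_small d20; move: discE BA AC.
case/orP: hD => /eqP->; rewrite /absdisc /=;
case: hA => ->; case: hB => [->|[->|->]] e1 e2 e3; try (by left); try (exfalso; lia).
  by right; left; split=> //; lia.
by right; right; split=> //; lia.
Qed.

End Arithmetic.

(** * Euclidean ideals: descent into a hole, and decrease of the norm *)

Section Euclid.
Variables (D : nat) (D_gt0 : (0 < D)%N) (sqD : squarefree D).
Local Notation w := (omega D).

Lemma norm_form_eval I a b A B C r (x y : rat) : QF D a -> QF D b ->
  norm_form D I a b A B C r ->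
  nrm (CQ x * a + CQ y * b) = r * qform A%:~R B%:~R C%:~R x y.
Proof.
move=> Ka Kb [_ e1 e2 e3 _]; rewrite (nrm_comb D) // e1 e2 e3 /qform.
by ring.
Qed.

Lemma zbasis_QF I a b : frac_ideal D I -> zbasis I a b -> QF D a /\ QF D b.
Proof.
move=> fI bI; split; apply: (frac_ideal_QF D I) => //; apply/bI.
  by exists 1, 0; rewrite mul1r mul0r addr0.
by exists 0, 1; rewrite mul1r mul0r add0r.
Qed.

(** A triangle inequality free of square roots: divide the norm of [th u + v], which is nonnegative,
    by [th]. *)
Lemma nrm_add_ge (th : rat) u v : 0 < th -> QF D u -> QF D v ->
  (1 - th) * nrm u - nrm v / th <= nrm (u + v).
Proof.
move=> th0 Ku Kv.
have e1 : nrm (u + v) = nrm u + trc u v + nrm v.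
  have -> : u + v = CQ 1 * u + CQ 1 * v by rewrite rmorph1 !mul1r.
  by rewrite (nrm_comb D) //; ring.
have : 0 <= nrm (CQ th * u + CQ 1 * v).
  by apply: (nrm_ge0 D) => //; apply: QF_add; apply: QF_mul => //; apply: QF_rat.
rewrite (nrm_comb D) // => h.
have nv := nrm_ge0 D D_gt0 v Kv.
have : 0 <= (th ^+ 2 * nrm u + th * 1 * trc u v + 1 ^+ 2 * nrm v) / th.
  by rewrite divr_ge0 // ltW.
have -> : (th ^+ 2 * nrm u + th * 1 * trc u v + 1 ^+ 2 * nrm v) / th
  = th * nrm u + trc u v + nrm v / th by field; rewrite gt_eqF.
by rewrite e1; lra.
Qed.

Lemma far_point C0 a b A B C r : frac_ideal D C0 -> zbasis C0 a b ->
  norm_form D C0 a b A B C r -> 0 < A -> 0 <= B -> B <= A -> A <= C ->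
  absdisc D < A * C * (A + C - B) ->
  exists (h : algC) (eta : rat), [/\ QF D h, 0 < eta & forall x, QF D x ->
    nrm (x - h) <= eta * r -> forall c, C0 c -> r <= nrm (x - c)].
Proof.
move=> fC bC nf A0 B0 BA AC rho.
have [Ka Kb] := zbasis_QF _ _ _ fC bC; have [[r0 _ _] _ _ _ dE] := nf.
have [s [t hole]] := circumcentre_hole A B C A0 B0 BA AC.
rewrite /= dE in hole; set R := (_ / _) in hole.
have d0 : (0 : rat) < (absdisc D)%:~R by rewrite ltr0z absdisc_gt0.
have R1 : 1 < R by rewrite ltr_pdivlMr // mul1r ltr_int.
have Kh : QF D (CQ s * a + CQ t * b).
  by apply: QF_add; apply: QF_mul => //; apply: QF_rat.
(* Chosen so that [(1 - th) R = (R + 1) / 2]. With [eta = th (R - 1) / 2] the perturbation costs at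
   most [(R - 1) / 2], which leaves exactly 1, in units of [r]. *)
pose th := (R - 1) / (2 * R).
have R0 : R != 0 by rewrite gt_eqF //; lra.
have th0 : 0 < th by rewrite divr_gt0 //; lra.
have th0' : th != 0 by rewrite gt_eqF.
have thR : (1 - th) * R = (R + 1) / 2 by rewrite /th; field.
have th1 : 0 < 1 - th.
  have -> : 1 - th = (R + 1) / (2 * R) by rewrite /th; field.
  by rewrite divr_gt0 //; lra.
exists (CQ s * a + CQ t * b), (th * (R - 1) / 2); split=> //.
  by rewrite divr_gt0 // mulr_gt0 //; lra.
move=> x Kx xh c Cc; have Kc : QF D c := frac_ideal_QF D _ _ fC Cc.
have /bC [i [j cE]] := Cc.
have nhc : R * r <= nrm (CQ s * a + CQ t * b - c).
  have -> : CQ s * a + CQ t * b - c = CQ (s - i%:~R) * a + CQ (t - j%:~R) * b.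
    by rewrite cE; ring.
  by rewrite (norm_form_eval _ _ _ _ _ _ _ _ _ Ka Kb nf) mulrC ler_pM2l.
have -> : x - c = (CQ s * a + CQ t * b - c) + (x - (CQ s * a + CQ t * b)) by ring.
apply: le_trans (nrm_add_ge th _ _ th0 (QF_sub D _ _ Kh Kc) (QF_sub D _ _ Kx Kh)).
move: nhc xh; set N := nrm (_ + _ - c); set M := nrm (x - _) => nhc xh.
have h1 : (1 - th) * (R * r) <= (1 - th) * N by rewrite ler_pM2l.
have h2 : M / th <= (R - 1) / 2 * r.
  by rewrite ler_pdivrMr //; apply: le_trans xh _; rewrite le_eqVlt; apply/orP; left; apply/eqP; ring.
have h3 : (1 - th) * (R * r) = (R + 1) / 2 * r by rewrite mulrA thR.
by lra.
Qed.

(** Ideals of small norm are fine lattices: rounding in a reduced basis leaves an error of at most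
    [r (2 A + C) / 4], and [2 A + C <= 4 absdisc] since [absdisc >= 3 A C]. *)
Lemma approx_point I r h : frac_ideal D I -> isnorm D I r -> QF D h ->
  exists x, I x /\ nrm (x - h) <= r * (absdisc D)%:~R.
Proof.
move=> fI nI Kh.
have [a [b [A [B [C [r' [bI free nf [A0 B0 BA AC]]]]]]]] := reduced_basis D D_gt0 sqD I fI.
have [Ka Kb] := zbasis_QF _ _ _ fI bI.
have [nI' e1 e2 e3 dE] := nf; have rr := isnorm_unique D D_gt0 I r r' nI nI'.
rewrite -{r'}rr in nf nI' e1 e2 e3; have [r0 _ _] := nI.
have [x [y hE]] := qfree_span D _ _ _ Ka Kb free Kh.
have [n xn] := round_rat x; have [m ym] := round_rat y.
exists (n%:~R * a + m%:~R * b); split; first by apply/bI; exists n, m.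
have -> : n%:~R * a + m%:~R * b - h = CQ (- (x - n%:~R)) * a + CQ (- (y - m%:~R)) * b.
  by rewrite hE; ring.
have A0r : (0 : rat) <= A%:~R by rewrite ler0z ltW.
rewrite (nrm_comb D) //; apply: le_trans (round_form_bound _ _ _ _ _ _ _ _ _ _ _) _; rewrite ?e1 ?e2 ?e3.
- by rewrite -mulrN ler_pM2l // -rmorphN ler_int; lia.
- by rewrite ler_pM2l // ler_int.
- by lra.
- by lra.
- by rewrite mulr_ge0 // ltW.
- by rewrite mulr_ge0 // ?ler0z ?ltW //; lia.
have : 2 * A + C <= 4 * absdisc D by rewrite -dE; nia.
rewrite -(ler_int rat) !rmorphD !rmorphM /= => dle.
have : r * (2 * A%:~R + C%:~R) <= r * (4 * (absdisc D)%:~R) by rewrite ler_pM2l.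
by lra.
Qed.

Lemma Eset_step I C0 z : Eset D I -> int_ideal D C0 -> prodset I C0 z -> z != 0 ->
  Eset D (scaleset z^-1 (prodset I C0)).
Proof.
move=> [fI OI] iC Mz z0; have fC := int_ideal_frac D _ iC.
have fM := frac_ideal_prod D _ _ fI fC.
have Kz : QF D z := frac_ideal_QF D _ _ fM Mz.
split; first by apply: frac_ideal_scale => //; [apply: QF_inv | rewrite invr_eq0].
move=> x Ox; exists (x * z); split; first exact: frac_idealM fM Ox Mz.
by field.
Qed.

Lemma prodset_subr I C0 y : Eset D I -> C0 y -> prodset I C0 y.
Proof.
move=> [_ OI] Cy; rewrite -[y]mul1r; apply: prodset_mul => //.
by apply: OI; apply: (OK_int D 1).
Qed.

Lemma isnorm_step I C0 z ri r : QF D z -> z != 0 -> isnorm D I ri -> isnorm D C0 r ->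
  isnorm D (scaleset z^-1 (prodset I C0)) (ri * (r / nrm z)).
Proof.
move=> Kz z0 nI nC.
have := isnorm_scale D D_gt0 z^-1 _ _ (QF_inv D D_gt0 _ Kz) _ (isnorm_prod D _ _ _ _ nI nC).
rewrite (nrmV D) // invr_eq0 => /(_ z0).
by have -> : (nrm z)^-1 * (ri * r) = ri * (r / nrm z) by ring.
Qed.

Lemma isnorm_OK : isnorm D (OK D) 1.
Proof.
split=> //.
  move=> x y Ox Oy; rewrite rmorph1 divr1; apply: OK_mul => //; exact: OK_conj.
rewrite rmorph1 -[1]mulr1; apply: prodset_mul; first exact: (OK_int D 1).
by rewrite conjC1; exact: (OK_int D 1).
Qed.

(** Strong induction on [psi I] over the ideals whose norm [ri] satisfies [ri * absdisc <= eta]. The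
    bound persists because the new norm is [ri * (r / nrm (x + y))] with [nrm (x + y) >= r]. *)
Lemma not_euclidean C0 a b A B C r : int_ideal D C0 -> zbasis C0 a b ->
  norm_form D C0 a b A B C r -> 0 < A -> 0 <= B -> B <= A -> A <= C ->
  absdisc D < A * C * (A + C - B) -> forall psi, ~ euclid_alg D C0 psi.
Proof.
move=> iC bC nf A0 B0 BA AC rho psi alg; have fC := int_ideal_frac D _ iC.
have [h [eta [Kh eta0 far]]] := far_point _ _ _ _ _ _ _ fC bC nf A0 B0 BA AC rho.
have [nC _ _ _ _] := nf; have [r0 _ _] := nC.
have d0 : (0 : rat) < (absdisc D)%:~R by rewrite ltr0z absdisc_gt0.
have step n : forall I ri, psi I = n -> Eset D I -> isnorm D I ri ->
    ri * (absdisc D)%:~R <= eta -> False.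
  elim/ltn_ind: n => n IH I ri psin EI nI ri_le.
  have [fI _] := EI; have fM := frac_ideal_prod D _ _ fI fC.
  have nM := isnorm_prod D _ _ _ _ nI nC.
  have [x [Mx xh]] := approx_point _ _ _ fM nM Kh.
  have Kx : QF D x := frac_ideal_QF D _ _ fM Mx.
  have {}xh : nrm (x - h) <= eta * r.
    by apply: le_trans xh _; rewrite mulrAC ler_pM2r.
  (* Otherwise [far] applied with [c = x] would give [r <= 0]. *)
  have Cx : ~ C0 x.
    move=> Cx; have := far x Kx xh x Cx; rewrite subrr -(rmorph0 CQ) (nrm_rat D D_gt0).
    by rewrite expr0n /=; lra.
  have [y [Cy lt_psi]] := alg I EI x Mx Cx; rewrite psin in lt_psi.
  have nz : r <= nrm (x + y).
    by have := far x Kx xh (- y) (frac_idealN D _ _ fC Cy); rewrite opprK.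
  have Mz : prodset I C0 (x + y) by apply: prodset_add => //; apply: prodset_subr.
  have Kz : QF D (x + y) := frac_ideal_QF D _ _ fM Mz.
  have z0 : x + y != 0 by rewrite -(nrm_gt0 D) //; lra.
  apply: (IH _ lt_psi _ (ri * (r / nrm (x + y))) erefl); [exact: Eset_step | exact: isnorm_step |].
  apply: le_trans ri_le; rewrite ler_pM2r //; have [ri0 _ _] := nI.
  by rewrite -[leRHS]mulr1 ler_pM2l // ler_pdivrMr ?mul1r //; lra.
(* The descent starts at [k^-1] times the ring of integers, of norm [k^-2]; the successor keeps [k]
   nonzero. *)
pose k := (Num.bound ((absdisc D)%:~R / eta)).+1.
have k_gt : (absdisc D)%:~R / eta <= k%:R.
  apply: le_trans (ltW (archi_boundP _)) _; first by rewrite divr_ge0 // ltW.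
  by rewrite ler_nat.
have kn0 : k%:R != 0 :> algC by rewrite pnatr_eq0.
have k0 : (0 : rat) < k%:R by rewrite ltr0n.
have Kk : QF D k%:R by rewrite -(rmorph_nat CQ); apply: QF_rat.
apply: (step _ (scaleset k%:R^-1 (OK D)) (nrm k%:R^-1 * 1) erefl).
- split; first by apply: frac_ideal_scale; [| | apply: QF_inv | rewrite invr_eq0 |
    apply/int_ideal_frac/int_ideal_OK].
  move=> x Ox; exists (k%:R * x); split; last by field.
  by apply: OK_mul => //; apply: (OK_int D k).
- by apply: isnorm_scale => //; [apply: QF_inv | rewrite invr_eq0 | apply: isnorm_OK].
- have -> : nrm k%:R^-1 = (k%:R ^+ 2)^-1.
    by rewrite (nrmV D) // -(rmorph_nat CQ) (nrm_rat D).
  rewrite mulr1 mulrC ler_pdivrMr ?exprn_gt0 //.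
  move: k_gt; rewrite ler_pdivrMr // => /le_trans; apply.
  rewrite mulrC ler_pM2l // -[leLHS]mulr1 expr2 ler_pM2l // ler1n.
  by [].
Qed.

(** The covering result yields [y] with [nrm (x + y) < r], so the factor [r / nrm (x + y)] by which
    the norm changes exceeds 1. Both positive criteria below rest on this step. *)
Lemma closer_point C0 a b A B C r : int_ideal D C0 -> zbasis C0 a b -> qfree a b ->
  norm_form D C0 a b A B C r -> 0 < A ->
  A * C * (A + C - B) < absdisc D ->
  forall I ri x, Eset D I -> isnorm D I ri -> prodset I C0 x -> ~ C0 x ->
  exists y rj, [/\ C0 y, Eset D (scaleset (x + y)^-1 (prodset I C0)), ri < rj
    & isnorm D (scaleset (x + y)^-1 (prodset I C0)) rj].
Proof.
move=> iC bC free nf A0 rho I ri x EI nI Mx nCx.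
have fC := int_ideal_frac D _ iC; have [fI _] := EI.
have fM := frac_ideal_prod D _ _ fI fC; have Kx : QF D x := frac_ideal_QF D _ _ fM Mx.
have [Ka Kb] := zbasis_QF _ _ _ fC bC; have [nC e1 e2 e3 dE] := nf.
have [r0 _ _] := nC; have [ri0 _ _] := nI.
have [s [t xE]] := qfree_span D _ _ _ Ka Kb free Kx.
have [||| i [j ij]] := plane_cover A%:~R B%:~R C%:~R _ _ s t.
- by rewrite ltr0z.
- by have := absdisc_gt0 D D_gt0; rewrite -dE -(ltr0z rat) rmorphB !rmorphM /=.
- by move: rho; rewrite -dE -(ltr_int rat) rmorphB !rmorphM rmorphB rmorphD /=.
pose y := (- i)%:~R * a + (- j)%:~R * b.
have Cy : C0 y by apply/bC; exists (- i), (- j).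
have zE : x + y = CQ (s - i%:~R) * a + CQ (t - j%:~R) * b by rewrite xE /y; ring.
have nz : nrm (x + y) < r.
  by rewrite zE (norm_form_eval _ _ _ _ _ _ _ _ _ Ka Kb nf) -[ltRHS]mulr1 ltr_pM2l.
have Mz : prodset I C0 (x + y) by apply: prodset_add => //; apply: prodset_subr.
have Kz : QF D (x + y) := frac_ideal_QF D _ _ fM Mz.
have z0 : x + y != 0.
  apply/eqP => /eqP; rewrite addr_eq0 => /eqP xy; apply: nCx.
  by rewrite xy; apply: frac_idealN fC Cy.
exists y, (ri * (r / nrm (x + y))); split=> //; [exact: Eset_step | | exact: isnorm_step].
by rewrite -[ltLHS]mulr1 ltr_pM2l // ltr_pdivlMr ?mul1r // (nrm_gt0 D).
Qed.

Lemma int_ideal_finv I : Eset D I -> int_ideal D (Defs.finv D I).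
Proof.
move=> [fI OI]; split.
- by move=> x [_ /(_ 1)]; rewrite mulr1; apply; apply: OI; apply: (OK_int D 1).
- split=> [|v _]; first exact: (proj1 (OK_int D 0)).
  by rewrite mul0r; apply: (OK_int D 0).
- by case: fI => _ [d [Od d0 dI]]; exists d; split=> //; split=> //; case: Od.
- move=> x y [Kx hx] [Ky hy]; split; first exact: QF_add.
  by move=> v Iv; rewrite mulrDl; apply: OK_add; [apply: hx | apply: hy].
- move=> u x Ou [Kx hx]; split; first by apply: QF_mul => //; case: Ou.
  by move=> v Iv; rewrite -mulrA; apply: OK_mul => //; apply: hx.
Qed.

(** The inverse of [I] is an integral ideal of norm the reciprocal of that of [I], and this norm is
    its index. *)
Lemma Eset_norm I : Eset D I -> exists n : nat,
  isnorm D I n%:R^-1 /\ ideal_index D (Defs.finv D I) n.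
Proof.
move=> EI; have [fI _] := EI; have [r nI] := isnorm_exists D D_gt0 sqD I fI.
have [n [rn idx]] := isnorm_index D D_gt0 sqD _ _ (int_ideal_finv I EI)
  (isnorm_finv D D_gt0 _ _ fI nI).
by exists n; rewrite -rn invrK.
Qed.

Lemma isnorm_lt I I' r r' (m n : nat) :
  isnorm D I n%:R^-1 -> isnorm D I' m%:R^-1 -> isnorm D I r -> isnorm D I' r' ->
  r < r' -> (m < n)%N.
Proof.
move=> hn hm hr hr' rr'; have [n0 _ _] := hn; have [m0 _ _] := hm.
rewrite -(isnorm_unique D D_gt0 _ _ _ hn hr) -(isnorm_unique D D_gt0 _ _ _ hm hr') in rr'.
move: rr'; rewrite ltf_pV2 ?ltr_nat // posrE -invr_gt0 //.
Qed.

Lemma norm_euclideanP C0 a b A B C r : int_ideal D C0 -> zbasis C0 a b -> qfree a b ->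
  norm_form D C0 a b A B C r -> 0 < A ->
  A * C * (A + C - B) < absdisc D -> norm_euclidean D C0.
Proof.
move=> iC bC free nf A0 rho; split=> // I EI x Mx nCx.
have [fI _] := EI; have [ri nI] := isnorm_exists D D_gt0 sqD I fI.
have [y [rj [Cy EI' lt_r nI']]] :=
  closer_point _ _ _ _ _ _ _ iC bC free nf A0 rho I ri x EI nI Mx nCx.
exists y; split=> //; have [n [hn idn]] := Eset_norm _ EI; have [m [hm idm]] := Eset_norm _ EI'.
by exists m, n; split=> //; apply: isnorm_lt hn hm nI nI' lt_r.
Qed.

Lemma euclidean_idealP C0 a b A B C r : int_ideal D C0 -> zbasis C0 a b -> qfree a b ->
  norm_form D C0 a b A B C r -> 0 < A ->
  A * C * (A + C - B) < absdisc D -> euclidean_ideal D C0.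
Proof.
move=> iC bC free nf A0 rho; split=> //.
(* The index of the inverse ideal as a total function on predicates; its value is unspecified where
   no such [n] exists. *)
pose psi I := epsilon (inhabits 0%N) (fun n : nat => isnorm D I n%:R^-1).
have psiP I : Eset D I -> isnorm D I (psi I)%:R^-1.
  move=> EI; apply: (epsilon_spec (inhabits 0%N) (fun n : nat => isnorm D I n%:R^-1)).
  by have [n [hn _]] := Eset_norm I EI; exists n.
exists psi => I EI x Mx nCx.
have [fI _] := EI; have [ri nI] := isnorm_exists D D_gt0 sqD I fI.
have [y [rj [Cy EI' lt_r nI']]] :=
  closer_point _ _ _ _ _ _ _ iC bC free nf A0 rho I ri x EI nI Mx nCx.
exists y; split=> //.
exact: isnorm_lt (psiP _ EI) (psiP _ EI') nI nI' lt_r.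
Qed.

End Euclid.

(** * Ideal classes and class numbers *)

Section ClassGroup.
Variables (D : nat) (D_gt0 : (0 < D)%N) (sqD : squarefree D).
Local Notation w := (omega D).

Lemma ideal_equiv_sym I J : ideal_equiv D I J -> ideal_equiv D J I.
Proof.
move=> [a [Ka a0 aI]]; exists a^-1; split; [exact: QF_inv | by rewrite invr_eq0 |].
move=> z; split=> [Iz|[y [/aI [x [Ix ->]] ->]]]; last by rewrite mulKf.
exists (a * z); split; last by rewrite mulKf.
by apply/aI; exists z.
Qed.

Lemma ideal_equiv_trans I J L :
  ideal_equiv D I J -> ideal_equiv D J L -> ideal_equiv D I L.
Proof.
move=> [a [Ka a0 aI]] [b [Kb b0 bJ]]; exists (b * a).
split; [exact: QF_mul | exact: mulf_neq0 |] => z; split.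
  move=> /bJ [y [/aI [x [Ix ->]] ->]]; exists x; split=> //; ring.
move=> [x [Ix ->]]; apply/bJ; exists (a * x); split; last by ring.
by apply/aI; exists x.
Qed.

Lemma isnorm_ext I J r : (forall z, I z <-> J z) -> isnorm D I r -> isnorm D J r.
Proof.
move=> IJ [r0 Ir rI]; split=> // [x y /IJ Ix /IJ Iy|]; first exact: Ir.
move: rI; apply: prodset_ind; [exact: prodset0 | by move=> *; apply: prodset_add |].
by move=> x y /IJ Jx /IJ Jy; apply: prodset_mul.
Qed.

(** Here [a] has the norm [r] of the ideal, so for [z] in [I] the integral number [z a^* / r] is
    [z / a]. *)
Lemma norm_form_principal I a b B C r : zbasis I a b -> frac_ideal D I ->
  norm_form D I a b 1 B C r -> a != 0 /\ forall z, I z <-> scaleset a (OK D) z.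
Proof.
move=> bI fI [[r0 Ir _] na _ _ _]; have [Ka _] := zbasis_QF D _ _ _ fI bI.
have Ia : I a by apply/bI; exists 1, 0; rewrite mul1r mul0r addr0.
have a0 : a != 0 by rewrite -(nrm_gt0 D) // na mulr1.
have ac0 : a^* != 0 by rewrite conjC_eq0.
split=> // z; split=> [Iz|[u [Ou ->]]]; last first.
  by rewrite mulrC; apply: frac_idealM fI Ou Ia.
exists (z / a); split; last by field.
have := Ir _ _ Iz Ia; rewrite mulr1 in na; rewrite -na (nrmE D) //.
by have -> : z * a^* / (a * a^*) = z / a by field; apply/andP.
Qed.

Lemma principal_equiv I a : QF D a -> a != 0 ->
  (forall z, I z <-> scaleset a (OK D) z) -> ideal_equiv D (OK D) I.
Proof. by move=> Ka a0 Ia; exists a. Qed.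

(** Equivalently, [b / a] is a root of [A X^2 - B X + C]. *)
Lemma norm_form_root I a b A B C r : QF D a -> QF D b -> norm_form D I a b A B C r ->
  A%:~R * b ^+ 2 - B%:~R * a * b + C%:~R * a ^+ 2 = 0.
Proof.
move=> Ka Kb [[r0 _ _] e1 e2 e3 _]; have rn0 := CQ_neq0 _ r0.
have E1 : CQ r * A%:~R = a * a^* by rewrite -(nrmE D) // e1 (rmorphM CQ) /= ratr_int.
have E2 : CQ r * B%:~R = a * b^* + a^* * b.
  by rewrite -(trcE D) // e2 (rmorphM CQ) /= ratr_int.
have E3 : CQ r * C%:~R = b * b^* by rewrite -(nrmE D) // e3 (rmorphM CQ) /= ratr_int.
apply: (mulfI rn0); rewrite mulr0.
transitivity (CQ r * A%:~R * b ^+ 2 - CQ r * B%:~R * a * b + CQ r * C%:~R * a ^+ 2); first by ring.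
by rewrite E1 E2 E3; ring.
Qed.

(** Up to scaling a lattice is determined by the ratio [t = b / a]; passing to [1 - t] or [t^-1]
    amounts to the basis change [(a, a - b)] or [(b, a)]. *)
Lemma zbasis_equiv I J a b a' b' : frac_ideal D I -> frac_ideal D J ->
  zbasis I a b -> zbasis J a' b' -> a != 0 -> a' != 0 ->
  b' / a' = b / a \/ b' / a' = 1 - b / a \/ (b / a) * (b' / a') = 1 -> ideal_equiv D I J.
Proof.
move=> fI fJ bI bJ a0 a'0.
have [Ka Kb] := zbasis_QF D _ _ _ fI bI; have [Ka' Kb'] := zbasis_QF D _ _ _ fJ bJ.
have bE : b = b / a * a by rewrite mulfVK.
have bE' : b' = b' / a' * a' by rewrite mulfVK.
move: (b / a) (b' / a') bE bE' => t t' bE bE'.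
have Kq : QF D (a' / a) by apply: QF_mul => //; apply: QF_inv.
have q0 : a' / a != 0 by rewrite mulf_neq0 ?invr_eq0.
case=> [tt'|[tt'|tt']].
- exists (a' / a); split=> // z; split=> [/bJ [x [y ->]]|[_ [/bI [x [y ->]] ->]]].
    exists (x%:~R * a + y%:~R * b); split; first by apply/bI; exists x, y.
    by rewrite bE bE' tt'; field.
  by apply/bJ; exists x, y; rewrite bE bE' tt'; field.
- exists (a' / a); split=> // z; split=> [/bJ [x [y ->]]|[_ [/bI [x [y ->]] ->]]].
    exists ((x + y)%:~R * a + (- y)%:~R * b); split; first by apply/bI; exists (x + y), (- y).
    by rewrite bE bE' tt'; field.
  by apply/bJ; exists (x + y), (- y); rewrite bE bE' tt'; field.
- have t'0 : t' != 0 by apply/eqP => t'0; move/eqP: tt'; rewrite t'0 mulr0 eq_sym oner_eq0.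
  have b'0 : b' != 0 by rewrite bE' mulf_neq0.
  have tE : t = t'^-1 by apply: (mulIf t'0); rewrite mulVf.
  exists (b' / a); split; [by apply: QF_mul => //; apply: QF_inv | by rewrite mulf_neq0 ?invr_eq0|].
  move=> z; split=> [/bJ [x [y ->]]|[_ [/bI [x [y ->]] ->]]].
    exists (y%:~R * a + x%:~R * b); split; first by apply/bI; exists y, x.
    by rewrite bE bE' tE; field; rewrite ?a0 ?t'0.
  by apply/bJ; exists y, x; rewrite bE bE' tE; field; rewrite ?a0 ?t'0.
Qed.

(** Both ratios are roots of one quadratic polynomial: they coincide, or Vieta's formulas give their
    sum and product. *)
Lemma norm_form_roots I J a b a' b' A B C r r' : frac_ideal D I -> frac_ideal D J ->
  zbasis I a b -> zbasis J a' b' -> a != 0 -> a' != 0 -> 0 < A ->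
  norm_form D I a b A B C r -> norm_form D J a' b' A B C r' ->
  b' / a' = b / a \/ b' / a' = B%:~R / A%:~R - b / a /\ (b / a) * (b' / a') = C%:~R / A%:~R.
Proof.
move=> fI fJ bI bJ a0 a'0 A0 nI nJ.
have [Ka Kb] := zbasis_QF D _ _ _ fI bI; have [Ka' Kb'] := zbasis_QF D _ _ _ fJ bJ.
have := norm_form_root _ _ _ _ _ _ _ Ka Kb nI.
have := norm_form_root _ _ _ _ _ _ _ Ka' Kb' nJ.
have An0 : A%:~R != 0 :> algC by rewrite intr_eq0 gt_eqF.
have -> : b = b / a * a by rewrite mulfVK.
have -> : b' = b' / a' * a' by rewrite mulfVK.
rewrite !mulfK //; move: (b / a) (b' / a') => t t' e' e.
have {}e : A%:~R * t ^+ 2 - B%:~R * t + C%:~R = 0.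
  by apply: (mulIf (expf_neq0 2 a0)); rewrite mul0r -e; ring.
have {}e' : A%:~R * t' ^+ 2 - B%:~R * t' + C%:~R = 0.
  by apply: (mulIf (expf_neq0 2 a'0)); rewrite mul0r -e'; ring.
have /eqP : (t' - t) * (A%:~R * (t' + t) - B%:~R) = 0.
  rewrite -[RHS](subrr 0) -{1}e' -e.
  by ring.
rewrite mulf_eq0 !subr_eq0 => /orP[/eqP->|/eqP h]; first by left.
right; have t'E : t' = B%:~R / A%:~R - t by rewrite -h; field.
split=> //; have CE : C%:~R = B%:~R * t - A%:~R * t ^+ 2.
  by apply/eqP; rewrite -subr_eq0 -e; apply/eqP; ring.
by rewrite t'E CE; field.
Qed.

Definition gen2 (th z : algC) : Prop :=
  exists x y, [/\ OK D x, OK D y & z = 2 * x + th * y].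

Lemma OK2 : OK D 2.
Proof. exact: (OK_int D 2). Qed.

Lemma int_ideal_gen2 th : OK D th -> int_ideal D (gen2 th).
Proof.
move=> Oth; have O0 : OK D 0 := OK_int D 0; have O1 : OK D 1 := OK_int D 1.
split.
- by move=> _ [x [y [Ox Oy ->]]]; apply: OK_add; apply: OK_mul => //; apply: OK2.
- by exists 0, 0; split=> //; ring.
- exists 2; split; last by rewrite pnatr_eq0.
  by exists 1, 0; split=> //; ring.
- move=> _ _ [x [y [Ox Oy ->]]] [x' [y' [Ox' Oy' ->]]].
  by exists (x + x'), (y + y'); split; [exact: OK_add | exact: OK_add | ring].
- move=> c _ Oc [x [y [Ox Oy ->]]].
  by exists (c * x), (c * y); split; [exact: OK_mul | exact: OK_mul | ring].
Qed.

(** The product of the ideal [(2, th)] with its conjugate contains 4, [2 c] and [2 t], and the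
    Bezout relation combines them into 2. *)
Lemma isnorm_gen2 th (c t k u v : int) : OK D th -> th * th^* = (2 * c)%:~R ->
  th + th^* = t%:~R -> 2 * k + u * c + v * t = 1 -> isnorm D (gen2 th) 2.
Proof.
move=> Oth thN thT bez.
have q2 : CQ 2 = 2 by exact: (rmorph_nat CQ 2).
have O0 : OK D 0 := OK_int D 0; have O1 : OK D 1 := OK_int D 1.
split=> //.
  move=> _ _ [x [y [Ox Oy ->]]] [x' [y' [Ox' Oy' ->]]]; rewrite q2.
  have -> : (2 * x' + th * y')^* = 2 * x'^* + th^* * y'^*.
    by rewrite (rmorphD Num.conj) 2!(rmorphM Num.conj) /= (rmorph_nat Num.conj 2).
  have -> : (2 * x + th * y) * (2 * x'^* + th^* * y'^*) / 2
    = 2 * x * x'^* + x * th^* * y'^* + th * y * x'^* + c%:~R * y * y'^*.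
    transitivity ((4 * x * x'^* + 2 * x * th^* * y'^* + 2 * th * y * x'^*
      + (th * th^*) * y * y'^*) / 2); first by ring.
    by rewrite thN; field.
  by do ![apply: OK_add | apply: OK_mul | apply: OK_conj | apply: OK2 | apply: OK_int | assumption].
have P2 z : OK D z -> gen2 th (2 * z) by move=> Oz; exists z, 0; split=> //; ring.
have Pt z : OK D z -> gen2 th (th * z) by move=> Oz; exists 0, z; split=> //; ring.
have P2c : gen2 th 2^* by rewrite (rmorph_nat Num.conj 2) -[2]mulr1; apply: P2.
have Ptc : gen2 th th^*^* by rewrite conjCK; have := Pt 1 O1; rewrite mulr1.
have -> : CQ 2 = (2 * k%:~R) * 2 + (th * u%:~R) * th^* + (2 * v%:~R) * th^* + (th * v%:~R) * 2.
  rewrite q2; transitivity (2 * k%:~R * 2 + u%:~R * (th * th^*) + 2 * v%:~R * (th + th^*)); last by ring.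
  rewrite thN thT; transitivity (2 * (2 * k + u * c + v * t)%:~R : algC); last by ring.
  by rewrite bez mulr1.
do !apply: prodset_add; apply: prodset_mul => //; by [apply: P2; apply: OK_int | apply: Pt; apply: OK_int].
Qed.

(** If [a] scales the ideal to the whole ring, then [nrm a = 1 / 2], and the element [p] with
    [a * p = 1] is integral of norm 2. *)
Lemma gen2_not_principal th : OK D th -> isnorm D (gen2 th) 2 ->
  (forall z, OK D z -> nrm z <> 2) -> ~ ideal_equiv D (gen2 th) (OK D).
Proof.
move=> Oth n2 no2 [a [Ka a0 aP]].
have [p [Pp e]] : scaleset a (gen2 th) 1 by apply/aP; apply: (OK_int D 1).
have Op : OK D p by case: (int_ideal_gen2 th Oth) => h _ _ _ _; apply: h.
have n1 : isnorm D (OK D) (nrm a * 2).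
  by apply: isnorm_ext (isnorm_scale D D_gt0 a _ _ Ka a0 n2) => z; split=> /aP.
have na := isnorm_unique D D_gt0 _ _ _ n1 (isnorm_OK D D_gt0).
apply: (no2 p Op); have : nrm (a * p) = 1.
  by rewrite -e -(rmorph1 CQ) (nrm_rat D D_gt0) expr1n.
have Kp : QF D p by case: Op.
rewrite (nrmM D) // => ap.
have na0 : nrm a != 0 by rewrite (nrm_eq0 D).
by apply: (mulfI na0); rewrite ap na.
Qed.

Lemma nrm_int_omega (x y : int) : nrm (x%:~R + y%:~R * w)
  = (x ^+ 2 + omega_tr D * x * y + omega_nrm D * y ^+ 2)%:~R.
Proof.
have Kw := omega_QF D.
apply: CQ_inj; rewrite (nrmE D) //; last first.
  apply: QF_add; first by rewrite -ratr_int; apply: QF_rat.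
  by apply: QF_mul => //; rewrite -ratr_int; apply: QF_rat.
have -> : (x%:~R + y%:~R * w)^* = x%:~R + y%:~R * w^*.
  by rewrite (rmorphD Num.conj) (rmorphM Num.conj) /= 2!(rmorph_int Num.conj).
transitivity (x%:~R ^+ 2 + x%:~R * y%:~R * (w + w^*) + y%:~R ^+ 2 * (w * w^*)); first by ring.
by rewrite omega_mul_conj // omega_conj // ratr_int; ring.
Qed.

Lemma ideal_pow_principal C0 a k : (forall z, C0 z <-> scaleset a (OK D) z) ->
  forall z, ideal_pow D C0 k z <-> scaleset (a ^+ k) (OK D) z.
Proof.
move=> aC; elim: k => [|k IH] z /=.
  rewrite expr0; split=> [Oz|[y [Oy ->]]]; last by rewrite mul1r.
  by exists z; rewrite mul1r.
split.
  apply: prodset_ind => [|_ _ [x [Ox ->]] [y [Oy ->]]|x y /IH [x' [Ox ->]] /aC [y' [Oy ->]]].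
  - by exists 0; rewrite mulr0; split=> //; apply: (OK_int D 0).
  - by exists (x + y); rewrite mulrDr; split=> //; apply: OK_add.
  - by exists (x' * y'); rewrite exprSr mulrACA; split=> //; apply: OK_mul.
move=> [y [Oy ->]]; have -> : a ^+ k.+1 * y = (a ^+ k * y) * (a * 1) by rewrite exprSr; ring.
apply: prodset_mul; first by apply/IH; exists y.
by apply/aC; exists 1; split=> //; apply: (OK_int D 1).
Qed.

(** Powers of a principal ideal are principal, so they never reach the class of [P]. *)
Lemma not_generates_principal C0 P a : QF D a -> a != 0 ->
  (forall z, C0 z <-> scaleset a (OK D) z) -> frac_ideal D P ->
  ~ ideal_equiv D P (OK D) -> ~ generates_class_group D C0.
Proof.
move=> Ka a0 aC fP nP gen; apply: nP; have [k ek] := gen P fP.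
apply: ideal_equiv_trans ek _; apply: ideal_equiv_sym.
apply: (principal_equiv _ (a ^+ k)); last exact: ideal_pow_principal.
  elim: k => [|k IH]; first by rewrite expr0 -(rmorph1 CQ); apply: QF_rat.
  by rewrite exprS; apply: QF_mul.
exact: expf_neq0.
Qed.

Lemma class_number_one : D \in [:: 1; 2; 3; 7; 11]%N -> has_class_number D 1.
Proof.
move=> hD; exists (fun=> OK D); split.
- by move=> _; apply/int_ideal_frac/int_ideal_OK.
- by move=> i j _; rewrite !ord1.
move=> I fI; exists ord0.
have [a [b [A [B [C [r [bI free nf [A0 B0 BA AC]]]]]]]] := reduced_basis D D_gt0 sqD I fI.
have [_ _ _ _ dE] := nf; have [A1 _] := reduced_h1 D A B C A0 B0 BA AC dE hD.
rewrite A1 in nf; have [a0 aI] := norm_form_principal _ _ _ _ _ _ bI fI nf.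
have [Ka _] := zbasis_QF D _ _ _ fI bI.
exact: ideal_equiv_sym (principal_equiv _ _ Ka a0 aI).
Qed.

(* The two fields of class number two: [(2, 1 + sqrt (-5))] and
   [(2, (1 + sqrt (-15)) / 2)]. *)
Definition gen_h2 : algC := if D == 5%N then 1 + w else w.

Lemma OK_gen_h2 : OK D gen_h2.
Proof.
rewrite /gen_h2; case: ifP => _; last exact: OK_w.
by apply: OK_add; [apply: (OK_int D 1) | apply: OK_w].
Qed.

(** The ideal has norm 2, while [x^2 + 5 y^2] and [x^2 + x y + 4 y^2] do not represent 2. *)
Lemma gen_h2_nonprincipal : D \in [:: 5; 15]%N ->
  ~ ideal_equiv D (gen2 gen_h2) (OK D).
Proof.
move=> hD; have Og := OK_gen_h2.
have wc := omega_conj D D_gt0; have wn := omega_mul_conj D D_gt0.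
apply: gen2_not_principal => //.
  move: hD; rewrite !inE => /orP[/eqP hD|/eqP hD].
    have tE : omega_tr D = 0 by rewrite hD.
    have nE : omega_nrm D = 5 by rewrite hD.
    rewrite tE in wc; rewrite nE in wn.
    have gE : gen_h2 = 1 + w by rewrite /gen_h2 {1}hD eqxx.
    (* [1 + omega] has norm 6 and trace 2, with [2 (-1) + 3 = 1]; for [D = 15] below, [omega] has
       norm 4 and trace 1, and the trace alone suffices. *)
    apply: (isnorm_gen2 _ 3 2 (-1) 1 0) => //; rewrite gE.
      rewrite rmorphD rmorph1 /=; transitivity (1 + (w + w^*) + w * w^*); first by ring.
      by rewrite wn wc; ring.
    by rewrite rmorphD rmorph1 /= wc; ring.
  have tE : omega_tr D = 1 by rewrite hD.
  have nE : omega_nrm D = 4 by rewrite hD.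
  rewrite tE in wc; rewrite nE in wn.
  have gE : gen_h2 = w by rewrite /gen_h2 {1}hD.
  rewrite gE; apply: (isnorm_gen2 _ 2 1 0 0 1) => //; first by rewrite -gE.
  by rewrite wc; ring.
move=> z /(OK_omega D D_gt0 sqD) [x [y ->]]; rewrite nrm_int_omega => /eqP.
rewrite (eqr_int rat _ 2) => /eqP.
have sq2 (m : int) : m ^+ 2 != 2.
  apply/eqP => h; have : m = -1 \/ m = 0 \/ m = 1 by nia.
  by case=> [e|[e|e]]; rewrite e in h.
move: hD; rewrite !inE => /orP[/eqP hD|/eqP hD].
  have -> : omega_tr D = 0 by rewrite hD.
  have -> : omega_nrm D = 5 by rewrite hD.
  move=> h; have y0 : y = 0 by nia.
  by have /eqP := sq2 x; apply; rewrite -h y0; ring.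
have -> : omega_tr D = 1 by rewrite hD.
have -> : omega_nrm D = 4 by rewrite hD.
move=> h; have h8 : (2 * x + y) ^+ 2 + 15 * y ^+ 2 = 8.
  transitivity (4 * (x ^+ 2 + 1 * x * y + 4 * y ^+ 2)); first by ring.
  by rewrite h.
have y0 : y = 0 by have := sqr_ge0 (2 * x + y); nia.
by have /eqP := sq2 x; apply; rewrite -h y0; ring.
Qed.

Lemma frac_ideal_gen2 : frac_ideal D (gen2 gen_h2).
Proof. apply/int_ideal_frac/int_ideal_gen2; exact: OK_gen_h2. Qed.

(** A nonprincipal ideal has the same reduced form as [gen2 gen_h2], so the two basis ratios are
    equal or conjugate. Conjugate ratios have sum [B / A = 1] for [D = 5] and product [C / A = 1]
    for [D = 15], so [zbasis_equiv] applies. *)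
Lemma class_number_two : D \in [:: 5; 15]%N -> has_class_number D 2.
Proof.
move=> hD; have nP := gen_h2_nonprincipal hD; have fP := frac_ideal_gen2.
have fO : frac_ideal D (OK D) by apply/int_ideal_frac/int_ideal_OK.
exists (fun i : 'I_2 => if i == ord0 then OK D else gen2 gen_h2); split.
- by move=> i; case: ifP.
- move=> i j; case: eqP => [->|i0]; case: eqP => [->|j0] // e.
  + by case: nP; apply: ideal_equiv_sym.
  + by case: i j i0 j0 {e} => [[|[|i]] hi] [[|[|j]] hj] i0 j0; apply: val_inj => //=;
      [case: i0; apply: val_inj | case: j0; apply: val_inj].
move=> I fI.
have [a [b [A [B [C [r [bI free nf [A0 B0 BA AC]]]]]]]] := reduced_basis D D_gt0 sqD I fI.
have [a' [b' [A' [B' [C' [r' [bP free' nf' [A0' B0' BA' AC']]]]]]]] :=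
  reduced_basis D D_gt0 sqD _ fP.
have [_ _ _ _ dE] := nf; have [_ _ _ _ dE'] := nf'.
have [Ka Kb] := zbasis_QF D _ _ _ fI bI; have [Ka' Kb'] := zbasis_QF D _ _ _ fP bP.
have [A1|h] := reduced_h2 D A B C A0 B0 BA AC dE hD.
  rewrite A1 in nf; have [a0 aI] := norm_form_principal _ _ _ _ _ _ bI fI nf.
  by exists ord0; rewrite eqxx; apply: ideal_equiv_sym; apply: principal_equiv aI.
have [A1|h'] := reduced_h2 D A' B' C' A0' B0' BA' AC' dE' hD.
  rewrite A1 in nf'; have [a0 aI] := norm_form_principal _ _ _ _ _ _ bP fP nf'.
  by case: nP; apply: ideal_equiv_sym; apply: principal_equiv aI.
exists ord_max => /=.
have a0 := qfree_neq0 _ _ free; have a'0 := qfree_neq0 _ _ free'.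
apply: (zbasis_equiv _ _ a b a' b') => //.
case: h => -[EA EB EC ED]; case: h' => -[EA' EB' EC' ED'];
  rewrite ?ED // in ED'; rewrite {}EA {}EB {}EC in nf A0; rewrite {}EA' {}EB' {}EC' in nf';
  have [->|[e1 e2]] := norm_form_roots _ _ _ _ _ _ _ _ _ _ _ fI fP bI bP a0 a'0 A0 nf nf';
  try (by left); right.
  by left; rewrite e1 divff // pnatr_eq0.
by right; rewrite e2 divff // pnatr_eq0.
Qed.

End ClassGroup.

(** * The classification of Euclidean ideal classes *)

Theorem theorem1p1 (D : nat) (hD : (0 < D)%N) (hsq : squarefree D) :
  (has_euclidean_ideal D <-> D \in [:: 1; 2; 3; 5; 7; 11; 15]%N)
  /\ (D \in [:: 1; 2; 3; 7; 11]%N -> has_class_number D 1)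
  /\ (D \in [:: 5; 15]%N -> has_class_number D 2)
  /\ (D \in [:: 1; 2; 3; 5; 7; 11; 15]%N ->
        forall C : algC -> Prop, int_ideal D C ->
          generates_class_group D C -> norm_euclidean D C).
Proof.
have split_list : D \in [:: 1; 2; 3; 5; 7; 11; 15]%N ->
    D \in [:: 1; 2; 3; 7; 11]%N \/ D \in [:: 5; 15]%N.
  by rewrite !inE; do ![case: eqP => // _]; auto.
(* The comparisons are [18 < 20] for [D = 5] and [12 < 15] for [D = 15]. *)
have h2_radius (A B C : int) : (A = 1 \/ [/\ A = 2, B = 2, C = 3 & D = 5%N]
    \/ [/\ A = 2, B = 1, C = 2 & D = 15%N]) -> A <> 1 -> A * C * (A + C - B) < absdisc D.
  by case=> [//|[[-> -> -> ->]|[-> -> -> ->]]].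
split; first split.
- move=> [C0 [iC [psi alg]]]; have fC := int_ideal_frac D _ iC.
  apply/negPn/negP => nD.
  have [a [b [A [B [C [r [bC free nf [A0 B0 BA AC]]]]]]]] := reduced_basis D hD hsq C0 fC.
  have [_ _ _ _ dE] := nf.
  have rho := circumradius_gt1 D A B C A0 B0 BA AC dE hsq nD.
  exact: (not_euclidean D hD hsq C0 a b A B C r iC bC nf A0 B0 BA AC rho psi alg).
- case/split_list=> [h1|h2].
    exists (OK D); have iC := int_ideal_OK D; have fC := int_ideal_frac D _ iC.
    have [a [b [A [B [C [r [bC free nf [A0 B0 BA AC]]]]]]]] := reduced_basis D hD hsq _ fC.
    have [_ _ _ _ dE] := nf; have [_ rho] := reduced_h1 D A B C A0 B0 BA AC dE h1.
    exact: (euclidean_idealP D hD hsq _ a b A B C r).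
  have iC := int_ideal_gen2 D _ (OK_gen_h2 D hD hsq).
  exists (gen2 D (gen_h2 D)); have fC := int_ideal_frac D _ iC.
  have [a [b [A [B [C [r [bC free nf [A0 B0 BA AC]]]]]]]] := reduced_basis D hD hsq _ fC.
  have [_ _ _ _ dE] := nf; have [Ka _] := zbasis_QF D _ _ _ fC bC.
  apply: (euclidean_idealP D hD hsq _ a b A B C r) => //.
  apply: h2_radius (reduced_h2 D A B C A0 B0 BA AC dE h2) _ => A1.
  rewrite A1 in nf; have [a0 aI] := norm_form_principal D hD _ _ _ _ _ _ bC fC nf.
  apply: (gen_h2_nonprincipal D hD hsq h2); apply: ideal_equiv_sym => //.
  exact: principal_equiv aI.
split; first exact: class_number_one.
split; first exact: class_number_two.
move=> hl C0 iC gen; have fC := int_ideal_frac D _ iC.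
have [a [b [A [B [C [r [bC free nf [A0 B0 BA AC]]]]]]]] := reduced_basis D hD hsq _ fC.
have [_ _ _ _ dE] := nf; have [Ka _] := zbasis_QF D _ _ _ fC bC.
apply: (norm_euclideanP D hD hsq _ a b A B C r) => //.
case/split_list: hl => [h1|h2].
  by have [_ rho] := reduced_h1 D A B C A0 B0 BA AC dE h1.
(* [A = 1] would make [C0] principal, and then it could not generate the class of
   [gen2 (gen_h2 D)]. *)
apply: h2_radius (reduced_h2 D A B C A0 B0 BA AC dE h2) _ => A1.
rewrite A1 in nf; have [a0 aI] := norm_form_principal D hD _ _ _ _ _ _ bC fC nf.
apply: (not_generates_principal D hD _ _ _ Ka a0 aI (frac_ideal_gen2 D hD hsq) _ gen).
exact: gen_h2_nonprincipal.
Qed.
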